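(* Let $n\ge 1$ and for $i\in\{1,\dots,n\}$ let $\tau_i=\max\left(\frac{2n}{2n+i-1},\ \frac34+\frac1{12n}\right)$. Then for every fair division instance with agents $\{1,\dots,n\}$ (agent $i$ having priority rank $i$), a finite set $M$ of goods and additive valuations $v_1,\dots,v_n$, there exists a $(\tau_1,\dots,\tau_n)$-MMS allocation; that is, there is a partition $(X_1,\dots,X_n)$ of $M$ such that $v_i(X_i)\ge \tau_i\cdot \mathrm{MMS}_i$ for all $i\in\{1,\dots,n\}$.
   Context: A fair division instance consists of agents $\{1,\dots,n\}$, a finite set $M$ of indivisible goods, and additive valuations $v_i:2^M\to\mathbb{R}_{\ge 0}$, i.e. $v_i(S)=\sum_{g\in S}v_i(\{g\})$. The maximin share of agent $i$ is $\mathrm{MMS}_i=\max_{(P_1,\dots,P_n)}\min_{1\le j\le n}v_i(P_j)$, the maximum being over all partitions of $M$ into $n$ (possibly empty) bundles. Bundles in an allocation may also be empty. *)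

(* Defs.v *)
(* The real numbers are an arbitrary R : realType. *)
From mathcomp Require Import all_boot all_order all_algebra.
From mathcomp Require Import reals.

Set Implicit Arguments.
Unset Strict Implicit.
Unset Printing Implicit Defensive.

Import Order.TTheory GRing.Theory Num.Theory.
Local Open Scope ring_scope.

Definition additive_valuation (R : realType) (M : finType)
    (v : {set M} -> R) : Prop :=
  (forall S : {set M}, 0 <= v S) /\
  (forall S : {set M}, v S = \sum_(g in S) v [set g]).

(* Partition of M into n labelled bundles; unlike finset's [partition], bundles
   may be empty. *)
Definition is_allocation (n : nat) (M : finType)
    (X : {ffun 'I_n -> {set M}}) : bool :=
  [forall j, forall k, (j != k) ==> [disjoint X j & X k]]
  && (\bigcup_j X j == [set: M]).

(* The initial value v [set: M] is neutral, as every bundle is worth at most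
   that when v is an additive valuation; so this is the true minimum for
   0 < n; see [min_bundle_le] and [min_bundle_attained]. *)
Definition min_bundle (R : realType) (n : nat) (M : finType)
    (v : {set M} -> R) (X : {ffun 'I_n -> {set M}}) : R :=
  \big[Num.min/v [set: M]]_(j < n) v (X j).

(* The initial value 0 is neutral, as valuations are nonnegative; see
   [mms_attained] and [mms_upper]. *)
Definition mms (R : realType) (n : nat) (M : finType)
    (v : {set M} -> R) : R :=
  \big[Num.max/0]_(X : {ffun 'I_n -> {set M}} | is_allocation X)
     min_bundle v X.

Definition mms_allocation (R : realType) (n : nat) (M : finType)
    (v : 'I_n -> {set M} -> R) (t : 'I_n -> R)
    (X : {ffun 'I_n -> {set M}}) : Prop :=
  is_allocation X /\ forall i : 'I_n, t i * mms n (v i) <= v i (X i).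

(* r is the priority rank, counted from 1. *)
Definition tau (R : realType) (n r : nat) : R :=
  Num.max (2 * n%:R / (2 * n%:R + r%:R - 1)) (3 / 4 + 1 / (12 * n%:R)).

Lemma valuation_le (R : realType) (M : finType) (v : {set M} -> R)
    (S : {set M}) : additive_valuation v -> v S <= v [set: M].
Proof.
move=> [v0 vD]; rewrite (vD S) (vD setT) [leRHS](bigID (mem S)) /=.
under [in leRHS]eq_bigl => g do rewrite in_setT /=.
by rewrite lerDl; apply: sumr_ge0.
Qed.

Lemma min_bundle_le (R : realType) (n : nat) (M : finType)
    (v : {set M} -> R) (X : {ffun 'I_n -> {set M}}) (j : 'I_n) :
  min_bundle v X <= v (X j).
Proof. exact: bigmin_le_cond. Qed.

Lemma min_bundle_attained (R : realType) (n : nat) (M : finType)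
    (v : {set M} -> R) (X : {ffun 'I_n -> {set M}}) :
  (0 < n)%N -> additive_valuation v -> exists j, min_bundle v X = v (X j).
Proof.
move=> n0 hv; pose i0 := Ordinal n0.
have : min_bundle v X = v [set: M] \/ exists j, min_bundle v X = v (X j).
  rewrite /min_bundle; elim/big_ind: _ => [|x y hx hy|j _]; first by left.
    by rewrite minEle; case: ifP.
  by right; exists j.
case=> // e; exists i0; apply/eqP; rewrite eq_le {2}e valuation_le // andbT.
exact: min_bundle_le.
Qed.

Lemma mms_upper (R : realType) (n : nat) (M : finType) (v : {set M} -> R)
    (X : {ffun 'I_n -> {set M}}) :
  is_allocation X -> min_bundle v X <= mms n v.
Proof. by move=> hX; apply: le_bigmax_cond. Qed.

Lemma mms_attained (R : realType) (n : nat) (M : finType)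
    (v : {set M} -> R) :
  (0 < n)%N -> additive_valuation v ->
  exists X : {ffun 'I_n -> {set M}}, is_allocation X /\ mms n v = min_bundle v X.
Proof.
move=> n0 hv; pose i0 := Ordinal n0.
have : mms n v = 0 \/ exists X : {ffun 'I_n -> {set M}},
    is_allocation X /\ mms n v = min_bundle v X.
  rewrite /mms; elim/big_ind: _ => [|x y hx hy|X hX]; first by left.
    by rewrite maxEle; case: ifP.
  by right; exists X.
case=> // e; pose X := [ffun j : 'I_n => if j == i0 then [set: M] else set0].
have hX : is_allocation X.
  apply/andP; split.
    apply/forallP => j; apply/forallP => k; apply/implyP; rewrite !ffunE.
    have [->|_] := eqVneq j i0; last by rewrite -setI_eq0 set0I.
    by rewrite eq_sym => /negbTE->; rewrite -setI_eq0 setI0.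
  rewrite eqEsubset subsetT /=; apply/subsetP => g _.
  by apply/bigcupP; exists i0; rewrite // ffunE eqxx.
exists X; split=> //; apply/eqP; rewrite eq_le mms_upper // andbT e.
by have [j ->] := min_bundle_attained X n0 hv; case: hv.
Qed.

(* Main.v *)
(* All agents rank the goods in the same order: a picking sequence turns an
   allocation of ranks into one of goods.  With n agents left, the ranks {0},
   {2n-2, 2n-1, 2n} or {0, 2n} are given away as long as some agent reaches its
   threshold, the highest such agent being served; then the bags {k, 2n-1-k} are
   filled with the remaining goods in the same spirit.

   Agents with threshold t = 2n/(2n+i-1) only count the remaining value: what a
   lower agent receives is worth less than t to them, and what a higher one
   receives is worth at most 3t/2, except for pairs of goods above t/2, which
   are amortised ([rank_invariant]).

   Agents with threshold 3/4 + 1/(12n) keep a partition into bundles worth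
   exactly 1, up to a few dummy goods of total value at most 1/9.  If all bags
   are worth at most 1 to such an agent, a filled bag is worth at most
   4/3 (3/4 + 1/(12n)).  Otherwise filled bags are worth at most 8/9, and the
   excess of the bags above 1 is bounded by inspecting which goods can share a
   bundle with the most valuable ones ([large_pair_bound]). *)
Require Import Defs.
From mathcomp Require Import all_boot all_order all_algebra.
From mathcomp Require Import reals.
From mathcomp Require Import perm zify ring lra.
Import Order.TTheory GRing.Theory Num.Theory.
Local Open Scope ring_scope.

Set Implicit Arguments.
Unset Strict Implicit.
Unset Printing Implicit Defensive.

(** * Nonincreasing value sequences indexed by rank *)

Section Sequences.
Variable R : realFieldType.
Implicit Types s : nat -> R.

Definition descending s : Prop :=
  (forall r, 0 <= s r) /\ (forall p q, (p <= q)%N -> s q <= s p).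

Definition del (k : nat) s : nat -> R := fun r => s (bump k r).

Lemma descending_del k s : descending s -> descending (del k s).
Proof.
move=> [s0 sd]; split=> [r|p q pq]; first exact: s0.
by apply: sd; rewrite leq_bump2.
Qed.

Lemma sum_del k m s (P : pred nat) : (k <= m)%N ->
  \sum_(r < m.+1 | P r) s r =
  (if P k then s k else 0) + \sum_(r < m | P (bump k r)) del k s r.
Proof.
rewrite -ltnS => km; case: ifP => Pk.
  by rewrite (bigD1_ord (Ordinal km)).
rewrite add0r big_mkcond (bigD1_ord (Ordinal km)) //= Pk add0r.
by rewrite [RHS]big_mkcond.
Qed.

(** Rank [k] goes to [i0] and [a'] is shifted around it. The assignment is chosen before [s], as it
    must serve the value sequences of all agents. *)
Lemma assign_del (I : eqType) k m (i0 : I) (a' : nat -> I) : (k <= m)%N ->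
  exists a : nat -> I, forall i s,
    \sum_(r < m.+1 | a r == i) s r =
    (if i == i0 then s k else 0) + \sum_(r < m | a' r == i) del k s r.
Proof.
move=> km; exists (fun r => if r == k then i0 else a' (unbump k r)) => i s.
rewrite (sum_del _ (fun r => (if r == k then i0 else a' (unbump k r)) == i) km).
rewrite eqxx [i == _]eq_sym; congr (_ + _); apply: eq_bigl => r.
by rewrite [_ == k]eq_sym (negbTE (neq_bump _ _)) bumpK.
Qed.

Lemma sum_nat_split s a b c : (a <= b)%N -> (b <= c)%N ->
  \sum_(a <= r < c) s r = \sum_(a <= r < b) s r + \sum_(b <= r < c) s r.
Proof. by move=> ab bc; rewrite -big_cat_nat. Qed.

Lemma sum_nat_le s a b c : (forall r, (a <= r < b)%N -> s r <= c) ->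
  \sum_(a <= r < b) s r <= (b - a)%:R * c.
Proof.
move=> H; apply: (@le_trans _ _ (\sum_(a <= r < b) c)).
  by apply: ler_sum_nat.
by rewrite sumr_const_nat mulr_natl.
Qed.

End Sequences.

(** * The value-counting invariant under the three reductions *)

Section RankInvariant.
Variable R : realFieldType.
Implicit Types (s : nat -> R) (t : R).

Lemma del_lt k s r : (r < k)%N -> del k s r = s r.
Proof. by move=> rk; rewrite /del /bump leqNgt rk. Qed.

Lemma del_ge k s r : (k <= r)%N -> del k s r = s r.+1.
Proof. by move=> rk; rewrite /del /bump rk. Qed.

Lemma sum_del_low k s a b : (k <= a)%N ->
  \sum_(a <= r < b) del k s r = \sum_(a.+1 <= r < b.+1) s r.
Proof.
move=> ka; rewrite [RHS]big_add1 /=; apply: eq_big_nat => r /andP[ar _].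
by rewrite del_ge // (leq_trans ka).
Qed.

Lemma sum_del_high k s a b : (b <= k)%N ->
  \sum_(a <= r < b) del k s r = \sum_(a <= r < b) s r.
Proof.
move=> bk; apply: eq_big_nat => r /andP[_ rb].
by rewrite del_lt // (leq_trans rb).
Qed.

Lemma sum_del_mid k s a b : (a <= k)%N -> (k <= b)%N ->
  \sum_(a <= r < b) del k s r = \sum_(a <= r < b.+1) s r - s k.
Proof.
move=> ak kb; rewrite (sum_nat_split _ ak kb) sum_del_high // sum_del_low //.
rewrite (sum_nat_split s ak (leqW kb)).
rewrite [\sum_(k <= r < b.+1) _]big_ltn ?ltnS //; ring.
Qed.

(* Ranks start at 0: this is the bag {n-1-p, n+p}, so the n bags pair rank k
   with rank 2n-1-k and are listed from the middle outwards. *)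
Definition pair_value s n p : R := s (n - p.+1)%N + s (n + p)%N.

(* With n agents left, h of them of higher priority, this is the inequality
   "remaining value >= t * (n + h / 2)" that makes bag filling work when higher
   agents take at most 3t/2 each and the others less than t.  It is stated after
   the forced losses to higher agents: the K goods worth at least t, then the q
   middle bags worth at least t, whose total may exceed the 3t/2 budget. *)
Definition rank_invariant t n h m s : Prop := forall K q : nat,
  (K + q <= h)%N -> (forall r, (r < K)%N -> t <= s r) -> s K < t ->
  (forall p, (p < q)%N -> t <= pair_value s n p) -> pair_value s n q < t ->
  t * (n%:R - K%:R - q%:R) + t / 2 * (h%:R - K%:R - q%:R) <=
  \sum_(K <= r < n - q) s r + \sum_(n + q <= r < m) s r.

Lemma rank_drop (P : Prop) (h h' : nat) : (P /\ h' = h) \/ h = h'.+1 ->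
  (P /\ h%:R = h'%:R :> R) \/ h%:R = h'%:R + 1 :> R.
Proof. by case=> [[? ->]|->]; [left | right; rewrite natr1]. Qed.

(** The middle bags stay the same. If the top good is below [t], then [K = 0] and the loss fits the
    budget of either kind of recipient; otherwise the recipient is higher and the good joins the
    forced losses of the old invariant, used with [K.+1]. *)
Lemma rank_invariant_remove_top t n h h' m s : 0 <= t -> (h' < n)%N ->
  (n.*2 <= m)%N -> descending s -> rank_invariant t n.+1 h m.+1 s ->
  (s 0%N < t /\ h' = h) \/ h = h'.+1 -> rank_invariant t n h' m (del 0 s).
Proof.
move=> t0 h'n nm [s0 sd] J hh' K q Kqh HK HKt Hp Hq.
have E r : del 0 s r = s r.+1 by rewrite del_ge.
have pE p : (p <= q)%N -> pair_value (del 0 s) n p = pair_value s n.+1 p.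
  by move=> pq; rewrite /pair_value !E; congr (s _ + s _); lia.
have Hp' p : (p < q)%N -> t <= pair_value s n.+1 p.
  by move=> pq; rewrite -pE ?Hp // ltnW.
have Hq' : pair_value s n.+1 q < t by rewrite -pE.
rewrite !sum_del_low //.
have -> : (n - q).+1 = (n.+1 - q)%N by lia.
rewrite -addSn.
have [s0t|s0t] := ltP (s 0%N) t.
  have K0 : K = 0%N.
    case: K HK HKt {Kqh} => // K HK _; have := HK 0%N isT; rewrite E.
    by move=> /le_trans/(_ (sd 0%N 1%N isT)); rewrite leNgt s0t.
  subst K; have hh : (0 + q <= h)%N by case: hh' => [[_ <-]|->]; lia.
  have := J 0%N q hh (fun r => ltac:(done)) s0t Hp' Hq'.
  rewrite [\sum_(0 <= r < _) _]big_ltn; last lia.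
  case: (rank_drop hh') => [[? ->]|->]; rewrite -[n.+1%:R]natr1 => JJ; lra.
case: hh' => [[]|hE]; first by rewrite ltNge s0t.
have := J K.+1 q; rewrite hE addSn ltnS => /(_ Kqh) /(_ _) H.
have {}H := H (fun r => ltac:(by case: r => // r; rewrite ltnS => /HK;
  rewrite E)).
have := H ltac:(by rewrite -E) Hp' Hq'.
rewrite -[n.+1%:R]natr1 -[h'.+1%:R]natr1 -[K.+1%:R]natr1 => JJ; lra.
Qed.

Lemma rank_invariant_remove_pair t n h h' m s : 0 <= t -> (h' < n)%N ->
  (n.*2 < m)%N -> descending s -> rank_invariant t n.+1 h m.+2 s ->
  s 0%N < t -> (s 0%N + s n.+1.*2 < t /\ h' = h) \/ h = h'.+1 ->
  rank_invariant t n h' m (del n.*2.+1 (del 0 s)).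
Proof.
move=> t0 h'n nm [s0 sd] J s0t hh' K q Kqh HK HKt Hp Hq.
have E r : (r < n.*2.+1)%N -> del n.*2.+1 (del 0 s) r = s r.+1.
  by move=> rn; rewrite del_lt // del_ge.
have pE p : (p <= q)%N ->
  pair_value (del n.*2.+1 (del 0 s)) n p = pair_value s n.+1 p.
  by move=> pq; rewrite /pair_value !E; [congr (s _ + s _); lia | lia | lia].
have Hp' p : (p < q)%N -> t <= pair_value s n.+1 p.
  by move=> pq; rewrite -pE ?Hp // ltnW.
have Hq' : pair_value s n.+1 q < t by rewrite -pE.
have K0 : K = 0%N.
  case: K HK HKt {Kqh} => // K HK _; have := HK 0%N isT; rewrite E //.
  by move=> /le_trans/(_ (sd 0%N 1%N isT)); rewrite leNgt s0t.
subst K; rewrite sum_del_high; last lia.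
rewrite [X in _ <= _ + X]sum_del_mid; [|lia|lia].
rewrite !sum_del_low // del_ge //.
have -> : (n - q).+1 = (n.+1 - q)%N by lia.
rewrite -addSn.
have hh : (0 + q <= h)%N by case: hh' => [[_ <-]|->]; lia.
have := J 0%N q hh (fun r => ltac:(done)) s0t Hp' Hq'.
rewrite [\sum_(0 <= r < _) _]big_ltn; last lia.
(* The second good given away is at most the lower half of bag [q], hence below [t / 2]: a higher
   recipient takes at most [3t/2]. *)
have y1 : s n.+1.*2 <= s (n.+1 + q)%N by apply: sd; lia.
have y2 : s (n.+1 + q)%N <= s (n.+1 - q.+1)%N by apply: sd; lia.
move: Hq'; rewrite /pair_value => Hq'.
have -> : n.*2.+2 = n.+1.*2 by lia.
by case: (rank_drop hh') => [[? ->]|->]; rewrite -[n.+1%:R]natr1 => JJ; lra.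
Qed.

(* Removing three goods shifts the middle bags.  If q0 and q = q0 + d.+1 bags
   are forced before and after, the goods charged in addition are d.+2 tops, all
   but one below t - y and the last below t - y', and d goods of value at most
   y', where y <= y' <= t / 2; together with the three goods, each at most y,
   this fits in the budget of d.+2 agents, d.+1 of them higher. *)
Lemma rank_invariant_remove_triple t n h h' m s : 0 <= t -> (h' < n)%N ->
  (n.*2 <= m)%N -> descending s -> rank_invariant t n.+1 h m.+3 s ->
  s 0%N < t ->
  (s n.*2 + s n.*2.+1 + s n.*2.+2 < t /\ h' = h) \/ h = h'.+1 ->
  rank_invariant t n h' m (del n.*2 (del n.*2 (del n.*2 s))).
Proof.
move=> t0 h'n nm [s0 sd] J s0t hh' K q Kqh HK HKt Hp Hq.
have qn : (q < n)%N by lia.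
set s' := del _ _ in HK HKt Hp Hq *.
have E r : (r < n.*2)%N -> s' r = s r by move=> rn; rewrite /s' !del_lt.
have K0 : K = 0%N.
  case: K HK HKt {Kqh} => // K HK _; have := HK 0%N isT; rewrite E; last lia.
  by rewrite leNgt s0t.
subst K; clear HK HKt.
have -> : \sum_(0 <= r < n - q) s' r = \sum_(0 <= r < n - q) s r.
  by rewrite /s' !sum_del_high //; clear -qn h'n nm; lia.
have -> : \sum_(n + q <= r < m) s' r =
    \sum_(n + q <= r < m.+3) s r - (s n.*2 + s n.*2.+1 + s n.*2.+2).
  rewrite /s' !sum_del_mid; try (clear -qn h'n nm; lia).
  rewrite !del_ge //; ring.
have pE p : (p <= q)%N -> pair_value s' n p = s (n - p.+1)%N + s (n + p)%N.
  by move=> pq; rewrite /pair_value !E //; clear -qn pq; lia.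
have {}Hp p : (p < q)%N -> t <= s (n - p.+1)%N + s (n + p)%N.
  by move=> pq; rewrite -pE ?Hp // ltnW.
move: Hq; rewrite pE // => Hq.
(* A bag is worth no more before the removal than the bag of the same index after it, hence
   [q0 <= q]. *)
have exq : exists q0, pair_value s n.+1 q0 < t.
  exists q; apply: le_lt_trans Hq; rewrite /pair_value.
  by apply: lerD; apply: sd; clear -qn h'n nm; lia.
case: (ex_minnP exq) => q0 Hq0 minq0.
have qq0 : (q0 <= q)%N.
  apply: minq0; apply: le_lt_trans Hq; rewrite /pair_value.
  by apply: lerD; apply: sd; clear -qn h'n nm; lia.
have Hp0 p : (p < q0)%N -> t <= pair_value s n.+1 p.
  by move=> pq; rewrite leNgt; apply/negP => /minq0; rewrite leqNgt pq.
have hh : (0 + q0 <= h)%N by case: hh' => [[_ <-]|->]; clear -qq0 Kqh; lia.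
have := J 0%N q0 hh (fun r => ltac:(done)) s0t Hp0 Hq0.
move: Hq0; rewrite /pair_value subSS => Hq0.
have hR : h'%:R <= h%:R :> R by case: hh' => [[_ <-]|->]; rewrite ler_nat.
have S1 : s n.*2 <= s (n + q)%N by apply: sd; clear -qn qq0 nm; lia.
have S2 : s n.*2.+1 <= s (n + q)%N by apply: sd; clear -qn qq0 nm; lia.
have S3 : s n.*2.+2 <= s (n + q)%N by apply: sd; clear -qn qq0 nm; lia.
have [qE|qlt] := eqVneq q0 q.
  (* Otherwise the last forced bag before the removal and the first unforced bag after it share
     their lower good, although the upper good of the latter is worth at least as much. *)
  have q0E : q = 0%N.
    case: q qE Hp Hq Kqh qn {pE qq0 S1 S2 S3} => // q qE Hp Hq Kqh qn.
    have := Hp0 q; rewrite qE leqnn => /(_ isT); rewrite /pair_value => P1.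
    have P2 : s (n.+1 - q.+1)%N <= s (n - q.+2)%N.
      by apply: sd; clear -qn nm; lia.
    have P3 : s (n.+1 + q)%N = s (n + q.+1)%N by congr s; clear -qn nm; lia.
    by move: Hq; rewrite ltNge -P3; case/negP; apply: le_trans P1 _; lra.
  subst q q0; rewrite !subn0 !addn0.
  have nm3 : (n < m.+3)%N by clear -qn nm; lia.
  rewrite big_nat_recr //= [\sum_(n <= r < m.+3) _]big_ltn //.
  move: Hq0; rewrite subn0 addn0 => Hq0.
  have y0 : s n.+1 <= s n by apply: sd.
  have y1 : s n.*2 <= s n.+1 by apply: sd; clear -qn nm; lia.
  have y2 : s n.*2.+1 <= s n.+1 by apply: sd; clear -qn nm; lia.
  have y3 : s n.*2.+2 <= s n.+1 by apply: sd; clear -qn nm; lia.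
  by case: (rank_drop hh') => [[? ->]|->]; rewrite -[n.+1%:R]natr1 => JJ; lra.
have [d dE] : exists d, q = (q0 + d.+1)%N.
  by exists (q - q0).-1; move/eqP in qlt; clear -qlt qq0; lia.
have T1 : s (n - q0)%N < t - s (n.+1 + q0)%N by lra.
have [qq0n q0n nnq nqm] : [/\ n - q <= n - q0, n - q0 <= n.+1 - q0,
    n.+1 + q0 <= n + q & n + q <= m.+3]%N.
  by split; clear -qn dE nm; lia.
rewrite (sum_nat_split s (leq0n _) (leq_trans qq0n q0n)).
rewrite (sum_nat_split s qq0n q0n).
have -> : \sum_(n - q0 <= r < n.+1 - q0) s r = s (n - q0)%N.
  by rewrite subSn ?big_nat1 //; clear -qn dE nm; lia.
rewrite (sum_nat_split s nnq nqm).
have T2 : \sum_(n - q <= r < n - q0) s r <=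
    ((n - q0) - (n - q))%:R * (t - s (n + q)%N).
  apply: sum_nat_le => r /andP[r1 r2].
  have : s r <= s (n - q.+1)%N by apply: sd; clear -r1 r2; lia.
  lra.
have T3 : \sum_(n.+1 + q0 <= r < n + q) s r <=
    ((n + q) - (n.+1 + q0))%:R * s (n.+1 + q0)%N.
  by apply: sum_nat_le => r /andP[r1 r2]; apply: sd; clear -r1 r2; lia.
move: T2 T3.
have -> : ((n - q0) - (n - q))%N = d.+1 by clear -qn dE nm; lia.
have -> : ((n + q) - (n.+1 + q0))%N = d by clear -qn dE nm; lia.
move=> T2 T3 JJ.
have yy : s (n + q)%N <= s (n.+1 + q0)%N by apply: sd; clear -qn dE nm; lia.
have y0 := s0 (n + q)%N.
have y1t : 2 * s (n.+1 + q0)%N <= t.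
  have : s (n.+1 + q0)%N <= s (n - q0)%N by apply: sd; clear -qn dE nm; lia.
  lra.
have qR : q%:R = q0%:R + d%:R + 1 :> R by rewrite dE natrD -natr1; ring.
have d0 : 0 <= d%:R :> R by [].
move: T2 T3 JJ; rewrite qR -[n.+1%:R]natr1 -[d.+1%:R]natr1.
move: (s (n + q)%N) (s (n.+1 + q0)%N) S1 S2 S3 T1 yy y0 y1t (d%:R) d0 => y y1.
move=> S1 S2 S3 T1 yy y0 y1t D d0 T2 T3 JJ.
have X1 : 0 <= D * y by rewrite mulr_ge0.
have X2 : 0 <= D * (t - 2 * y1) by rewrite mulr_ge0 //; lra.
have X3 : 0 <= t * (h%:R - h'%:R) by rewrite mulr_ge0 //; lra.
lra.
Qed.

End RankInvariant.

(** * Pigeonhole, exchange and sorting arguments *)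

Section Combinatorics.

Lemma pigeonhole3 (I : finType) (S : {set I}) (g : nat -> I) (a N : nat) :
  (forall r, (a <= r < a + N)%N -> g r \in S) -> (#|S|.*2 < N)%N ->
  exists x y z, [/\ (a <= x)%N, (x < y)%N, (y < z)%N & (z < a + N)%N] /\
    g x = g y /\ g y = g z.
Proof.
move=> gS SN.
have [b bS b3] : exists2 b, b \in S &
    (2 < count (fun r => g r == b) (iota a N))%N.
  apply/exists_inP; apply: contraLR SN; rewrite negb_exists_in -leqNgt.
  move=> /forall_inP small.
  have -> : N = (\sum_(b in S) count (fun r => g r == b) (iota a N))%N.
    under eq_bigr do rewrite -sum1_count.
    rewrite (exchange_big_dep predT) //= -[LHS](size_iota a) -sum1_size.
    rewrite big_seq [RHS]big_seq; apply: eq_bigr => r; rewrite mem_iota => rN.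
    rewrite (bigD1 (g r)) ?eqxx ?andbT ?gS // big1 ?addn0 // => b.
    by case/andP=> /andP[_ /eqP->]; rewrite eqxx.
  apply: (@leq_trans (\sum_(b in S) 2)).
    by apply: leq_sum => b /small; rewrite -leqNgt.
  by rewrite sum_nat_const muln2.
have : sorted ltn [seq r <- iota a N | g r == b].
  by apply: sorted_filter; [exact: ltn_trans | exact: iota_ltn_sorted].
have : forall r, r \in [seq r <- iota a N | g r == b] ->
    (a <= r < a + N)%N /\ g r = b.
  by move=> r; rewrite mem_filter mem_iota => /andP[/eqP-> ->].
move: b3; rewrite -size_filter.
case: [seq _ <- _ | _] => [|x [|y [|z l]]] //= _ H /and3P[xy yz _].
have [/andP[ax _] gx] := H x ltac:(by rewrite !inE eqxx).
have [_ gy] := H y ltac:(by rewrite !inE eqxx orbT).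
have [/andP[_ zN] gz] := H z ltac:(by rewrite !inE eqxx !orbT).
by exists x, y, z; split=> //; rewrite gx gy gz.
Qed.

Variable R : realFieldType.
Implicit Types s : nat -> R.

Lemma sum_ge_uniq s m (P : pred nat) (l : seq nat) : (forall r, 0 <= s r) ->
  uniq l -> all (fun r => (r < m)%N && P r) l ->
  \sum_(r <- l) s r <= \sum_(r < m | P r) s r.
Proof.
move=> s0 ul /allP al.
have pl : perm_eq l [seq r <- iota 0 m | r \in l].
  apply: uniq_perm => //; first exact: filter_uniq (iota_uniq _ _).
  move=> r; rewrite mem_filter mem_iota /= add0n.
  by case rl: (r \in l) => //=; case/andP: (al _ rl) => ->.
rewrite (perm_big _ pl) big_filter /= -(big_mkord P).
rewrite /index_iota subn0 [leLHS]big_mkcond [leRHS]big_mkcond /=.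
apply: ler_sum => r _; case rl: (r \in l); last by case: ifP.
by case/andP: (al _ rl) => _ ->.
Qed.

Definition swap_ranks (x y r : nat) : nat :=
  if r == x then y else if r == y then x else r.

Lemma swap_ranksR x y : swap_ranks x y y = x.
Proof. by rewrite /swap_ranks eqxx; case: eqVneq. Qed.

Lemma swap_ranksN x y r : r != x -> r != y -> swap_ranks x y r = r.
Proof. by rewrite /swap_ranks => /negbTE-> /negbTE->. Qed.

(** Only the bundle of [x] can lose: one that held [k] receives [x], which is worth at least as
    much. *)
Lemma bundle_swap_ranks (I : eqType) s m (f : nat -> I) x k c :
  (x <= k < m)%N -> descending s -> c != f x ->
  \sum_(r < m | f r == c) s r <= \sum_(r < m | f (swap_ranks x k r) == c) s r.
Proof.
move=> /andP[xk km] [s0 sd] cx; have xm := leq_ltn_trans xk km.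
pose p := tperm (Ordinal xm) (Ordinal km).
have pE (r : 'I_m) : (p r : nat) = swap_ranks x k r.
  rewrite /p permE /= /swap_ranks -!val_eqE /=.
  by case: ifP => // _; case: ifP.
rewrite [leRHS](reindex_inj (@perm_inj _ p)) /=.
have pK (r : 'I_m) : swap_ranks x k (p r) = r.
  by rewrite -pE /p tpermK.
under [leRHS]eq_bigl do rewrite pK.
apply: ler_sum => r /eqP rc; rewrite pE /swap_ranks.
case: eqP => [rx|_]; first by move: cx; rewrite -rc rx eqxx.
by case: eqP => [->|//]; apply: sd.
Qed.

Lemma sort_ranks m (w : 'I_m -> R) : (forall i, 0 <= w i) ->
  exists (p : {perm 'I_m}) s, [/\ descending s, forall i : 'I_m, s i = w (p i)
    & forall r, (m <= r)%N -> s r = 0].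
Proof.
move=> w0; pose t := [tuple w i | i < m].
have /tuple_permP[p pE] : perm_eq (sort_tuple >=%R t) t by rewrite perm_sort.
exists p; set l := sort >=%R t; exists (nth 0 l).
have szl : size l = m by rewrite size_sort size_tuple.
have lE (i : 'I_m) : nth 0 l i = w (p i).
  rewrite /l [sort _ _]pE (nth_map i) ?size_enum_ord // nth_ord_enum.
  by rewrite tnth_mktuple.
have l0 r : 0 <= nth 0 l r.
  have [rm|mr] := ltnP r m; last by rewrite nth_default ?szl.
  by rewrite (lE (Ordinal rm)).
split=> [||r mr]; [split=> // a b ab | by [] | by rewrite nth_default ?szl].
have [bm|mb] := ltnP b m; last by rewrite nth_default ?szl.
apply: (sorted_leq_nth (leT := >=%R)) => //.
- by move=> y x z /= xy yz; apply: le_trans yz xy.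
- by move=> x /=.
- by rewrite /l; apply: sort_sorted => x y; apply: ge_total.
- by rewrite inE szl (leq_ltn_trans ab).
- by rewrite inE szl.
Qed.

(** Among the [r.+1] first sorted values, one has an original index of at least [r]; it is at most
    [s r] and at least [s' r]. *)
Lemma sort_ranks_le m (w : 'I_m -> R) (p : {perm 'I_m}) s s' :
  descending s -> descending s' -> (forall i : 'I_m, s' i = w (p i)) ->
  (forall r, (m <= r)%N -> s' r = 0) -> (forall i : 'I_m, w i <= s i) ->
  forall r, s' r <= s r.
Proof.
move=> [s0 sd] [_ sd'] s'E s'0 ws r.
have [rm|mr] := ltnP r m; last by rewrite s'0.
have [i ir pi] : exists2 i : 'I_m, (i <= r)%N & (r <= p i)%N.
  apply/exists_inP; apply: contraT; rewrite negb_exists_in => /forall_inP H.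
  have pr (i : 'I_r.+1) : (p (widen_ord rm i) < r)%N.
    by rewrite ltnNge H //= -ltnS.
  have /leq_card : injective (fun i => Ordinal (pr i)).
    move=> i j /(congr1 val) /= ij; apply/val_inj.
    by have /(congr1 val) := perm_inj (val_inj ij).
  by rewrite !card_ord ltnn.
apply: le_trans (sd' _ _ ir) _; rewrite s'E.
by apply: le_trans (ws _) _; apply: sd.
Qed.

End Combinatorics.

(** * Partitions into bundles worth 1, under the reductions *)

Section NormalPartitions.
Variable R : realFieldType.
Implicit Types s : nat -> R.

Definition bundle s m (I : eqType) (f : nat -> I) (b : I) : R :=
  \sum_(r < m | f r == b) s r.

(* [d b] is the value of dummy goods in bundle [b], compensating for the losses
   of earlier reductions. *)
Definition covering_partition n m s D : Prop :=
  exists (f : nat -> 'I_n) (d : 'I_n -> R), [/\ forall b, 0 <= d b,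
    forall b, 1 <= bundle s m f b + d b & \sum_b d b <= D].

Definition normal_partition n m s D : Prop :=
  exists (f : nat -> 'I_n) (d : 'I_n -> R), [/\ forall b, 0 <= d b,
    forall b, bundle s m f b + d b = 1 & \sum_b d b <= D].

(** Dividing the goods and the dummy value of each bundle by their total, which is at least 1, only
    lowers values; sorting keeps them below [s] by [sort_ranks_le]. *)
Lemma normalize n m s D : descending s -> covering_partition n m s D ->
  exists s', [/\ descending s', forall r, s' r <= s r &
    normal_partition n m s' D].
Proof.
move=> sd [f [d [d0 fd dD]]]; pose c b := bundle s m f b + d b.
have c1 b : 1 <= c b by exact: fd.
have cp b : 0 < c b by apply: lt_le_trans (c1 b).
have div_le x b : 0 <= x -> x / c b <= x.
  by move=> x0; rewrite ler_pdivrMr // ler_peMr.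
have w0 (i : 'I_m) : 0 <= s i / c (f i).
  by rewrite divr_ge0 ?(ltW (cp _)) //; case: sd.
have [p [s' [sd' s'E s'0]]] := sort_ranks w0.
exists s'; split=> //.
  apply: (@sort_ranks_le _ m (fun i => s i / c (f i)) p s s' sd sd' s'E s'0).
  by move=> i; apply: div_le; case: sd.
exists (fun r => if insub r is Some i then f (p i) else f r).
exists (fun b => d b / c b).
split=> [b|b|]; first by rewrite divr_ge0 ?(ltW (cp _)).
  have -> : bundle s' m
      (fun r => if insub r is Some i then f (p i) else f r) b =
      \sum_(i < m | f i == b) s i / c (f i).
    rewrite [RHS](reindex_inj (@perm_inj _ p)).
    by apply: eq_big => r; [rewrite valK | rewrite s'E].
  have -> : \sum_(i < m | f i == b) s i / c (f i) =
      \sum_(i < m | f i == b) s i / c b.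
    by apply: eq_bigr => i /eqP->.
  by rewrite -mulr_suml -mulrDl -/(bundle s m f b) -/(c b) divff ?gt_eqF.
by apply: le_trans dD; apply: ler_sum => b _; apply: div_le.
Qed.

Lemma bundle_del s m k (I : eqType) (f : nat -> I) b : (k <= m)%N ->
  bundle (del k s) m (fun r => f (bump k r)) b =
  bundle s m.+1 f b - (if f k == b then s k else 0).
Proof.
move=> km; rewrite /bundle (sum_del s (fun r => f r == b) km).
by rewrite [X in _ = X]addrC addKr.
Qed.

(** Common end of the reductions: bundles [a] and [b] become one, with dummy value [e] added. Label
    [a] disappears through [unlift], and [b'] is the new label of [b]. *)
Lemma covering_merge n m s (f : nat -> 'I_n.+2) d D e a b :
  descending s -> a != b -> 0 <= e -> (forall c, 0 <= d c) ->
  (forall c, c != a -> c != b -> 1 <= bundle s m f c + d c) ->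
  1 <= bundle s m f a + d a + (bundle s m f b + d b) + e ->
  \sum_c d c + e <= D -> covering_partition n.+1 m s D.
Proof.
move=> sd ab e0 d0 Hc Hab dD.
have [b' bb' _] := unlift_some ab.
exists (fun r => odflt b' (unlift a (f r))).
exists (fun c => d (lift a c) + (if c == b' then d a + e else 0)).
split=> [c||].
- by rewrite addr_ge0 //; case: ifP => // _; rewrite addr_ge0.
- move=> c; have -> : bundle s m (fun r => odflt b' (unlift a (f r))) c =
    bundle s m f (lift a c) + (if c == b' then bundle s m f a else 0).
    rewrite /bundle [LHS](bigID (fun r : 'I_m => f r == a)) /= addrC.
    congr (_ + _).
      apply: eq_bigl => r; case: unliftP => [j ->|->] /=.
        by rewrite (inj_eq lift_inj) [_ == a]eq_sym neq_lift andbT.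
      by rewrite eqxx andbF (negbTE (neq_lift _ _)).
    case: ifP => cb'.
      apply: eq_bigl => r; case: unliftP => [j ->|->] /=.
        by rewrite [_ == a]eq_sym (negbTE (neq_lift _ _)) andbF.
      by rewrite eqxx andbT eq_sym.
    apply: big_pred0 => r; case: unliftP => [j ->|->] /=.
      by rewrite [_ == a]eq_sym (negbTE (neq_lift _ _)) andbF.
    by rewrite eq_sym cb'.
  case: eqVneq => [->|cb']; first by rewrite -bb'; lra.
  rewrite !addr0; apply: Hc; first by rewrite eq_sym neq_lift.
  by rewrite bb' (inj_eq lift_inj).
apply: le_trans dD; rewrite big_split /= -big_mkcond big_pred1_eq.
rewrite (bigD1_ord a) //=; lra.
Qed.

Lemma covering_remove_top n m s D :
  descending s -> normal_partition n.+2 m.+1 s D ->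
  covering_partition n.+1 m (del 0 s) D.
Proof.
move=> sd [f [d [d0 fd dD]]].
pose a := f 0%N; pose b := lift a ord0.
have ab : a != b by exact: neq_lift.
apply: (@covering_merge n m (del 0 s) (fun r => f (bump 0 r)) d D 0 a b) => //.
- exact: descending_del.
- move=> c ca _; rewrite bundle_del // eq_sym (negbTE ca) subr0 fd //.
- rewrite !bundle_del // eqxx (negbTE ab).
  have fa := fd a; have fb := fd b.
  have : s 0%N <= bundle s m.+1 f a.
    rewrite /bundle (bigD1 ord0) //= lerDl; apply: sumr_ge0 => *.
    by case: sd.
  by have := d0 a; lra.
- by rewrite addr0.
Qed.

(** Bundles [a] and [b], worth 2 together, contain both goods and lose at most [1 + e]. If one
    bundle holds both goods, [b] is any other. Index [n.*2.+3] is the old rank [n.*2.+4] once rank 0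
    is gone. *)
Lemma covering_remove_pair n m s D e : (n.*2.+4 <= m.+1)%N -> descending s ->
  normal_partition n.+2 m.+2 s D -> 0 <= e -> s 0%N + s n.*2.+4 <= 1 + e ->
  covering_partition n.+1 m (del n.*2.+3 (del 0 s)) (D + e).
Proof.
move=> nm sd [f [d [d0 fd dD]]] e0 se.
pose a := f 0%N; pose b := if f n.*2.+4 == a then lift a ord0 else f n.*2.+4.
have ab : a != b.
  by rewrite /b; case: ifP => [_|/negbT]; [exact: neq_lift | rewrite eq_sym].
have E c : bundle (del n.*2.+3 (del 0 s)) m
    (fun r => f (bump 0 (bump n.*2.+3 r))) c =
    bundle s m.+2 f c - (if a == c then s 0%N else 0)
      - (if f n.*2.+4 == c then s n.*2.+4 else 0).
  by rewrite (bundle_del (del 0 s) (fun r => f (bump 0 r))) // bundle_del.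
apply: (@covering_merge n m _ (fun r => f (bump 0 (bump n.*2.+3 r))) d (D + e)
  e a b) => //.
- by do 2!apply: descending_del.
- move=> c ca cb; rewrite E eq_sym (negbTE ca) subr0.
  have fc : f n.*2.+4 != c.
    by move: cb; rewrite /b; case: (eqVneq (f n.*2.+4) a) => [-> _|_];
      rewrite eq_sym.
  by rewrite (negbTE fc) subr0 fd.
- rewrite !E eqxx (negbTE ab).
  have fa := fd a; have fb := fd b.
  move: fb; rewrite /b; case: (eqVneq (f n.*2.+4) a) => [fE|fE].
    by rewrite fE (negbTE (neq_lift _ _)) => fb; lra.
  by rewrite eqxx => fb; lra.
- by rewrite lerD2r.
Qed.

(** Three of the first [2n + 5] ranks share one of the [n + 2] bundles. Exchanging them with the
    last three of these ranks harms no other bundle; then only one bundle loses the triple, and its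
    remains join another. *)
Lemma covering_remove_triple n m s D : (n.*2.+2 <= m)%N -> descending s ->
  normal_partition n.+2 m.+3 s D ->
  covering_partition n.+1 m (del n.*2.+2 (del n.*2.+2 (del n.*2.+2 s))) D.
Proof.
move=> nm sd [f [d [d0 fd dD]]]; set k := n.*2.+2.
have [|x [y [z [[_ xy yz zk] [fxy fyz]]]]] :=
    @pigeonhole3 _ [set: 'I_n.+2] f 0 k.+3 (fun r _ => in_setT _).
  by rewrite cardsT card_ord /k; lia.
pose a := f x; pose b := lift a ord0.
have ab : a != b by exact: neq_lift.
(* The lowest of the three goes first, so that no exchange disturbs the other two. *)
pose f1 r := f (swap_ranks z k.+2 r).
pose f2 r := f1 (swap_ranks y k.+1 r).
pose f3 r := f2 (swap_ranks x k r).
have f1k : f1 k.+2 = a by rewrite /f1 swap_ranksR /a fxy fyz.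
have f1x : f1 x = a by rewrite /f1 swap_ranksN //; lia.
have f1y : f1 y = a by rewrite /f1 swap_ranksN ?/a ?fxy //; lia.
have f2k : f2 k.+1 = a by rewrite /f2 swap_ranksR.
have f2k' : f2 k.+2 = a by rewrite /f2 swap_ranksN //; lia.
have f2x : f2 x = a by rewrite /f2 swap_ranksN //; lia.
have f3k : f3 k = a by rewrite /f3 swap_ranksR.
have f3k' : f3 k.+1 = a by rewrite /f3 swap_ranksN //; lia.
have f3k2 : f3 k.+2 = a by rewrite /f3 swap_ranksN //; lia.
have f3c c : c != a -> 1 <= bundle s m.+3 f3 c + d c.
  move=> ca; rewrite -(fd c) lerD2r.
  apply: (@le_trans _ _ (bundle s m.+3 f1 c)).
    apply: bundle_swap_ranks => //; last by rewrite -fyz -fxy.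
    by rewrite /k; lia.
  apply: (@le_trans _ _ (bundle s m.+3 f2 c)).
    apply: bundle_swap_ranks => //; last by rewrite f1y.
    by rewrite /k; lia.
  apply: bundle_swap_ranks => //; last by rewrite f2x.
  by rewrite /k; lia.
have b1 : bump k k = k.+1 by rewrite /bump leqnn.
have b2 : bump k k.+1 = k.+2 by rewrite /bump leqW.
have E c : bundle (del k (del k (del k s))) m
    (fun r => f3 (bump k (bump k (bump k r)))) c =
    bundle s m.+3 f3 c -
      (if a == c then s k + s k.+1 + s k.+2 else 0).
  rewrite (bundle_del (del k (del k s)) (fun r => f3 (bump k (bump k r)))) //.
  rewrite (bundle_del (del k s) (fun r => f3 (bump k r))); last by rewrite leqW.
  rewrite bundle_del; last by rewrite !leqW.
  rewrite /= b1 b2 /del b1 b2 f3k f3k' f3k2.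
  by case: ifP => _; lra.
apply: (@covering_merge n m _ (fun r => f3 (bump k (bump k (bump k r)))) d D
  0 a b) => //.
- by do 3!apply: descending_del.
- by move=> c ca _; rewrite E eq_sym (negbTE ca) subr0 f3c.
- rewrite addr0 !E eqxx (negbTE ab) subr0.
  have : s k + s k.+1 + s k.+2 <= bundle s m.+3 f3 a.
    have := @sum_ge_uniq _ s m.+3 (fun r => f3 r == a) [:: k; k.+1; k.+2].
    rewrite !big_cons big_nil addr0 addrA; apply; first by case: sd.
      by rewrite /= !inE; lia.
    by rewrite /= f3k f3k' f3k2 eqxx /k; lia.
  have := f3c b; rewrite eq_sym => /(_ ab).
  by have := d0 a; lra.
- by rewrite addr0.
Qed.

End NormalPartitions.

(** * From the invariant to a bag-filling budget *)

Section Ready.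
Variable R : realFieldType.
Implicit Types (s : nat -> R) (t : R).

Lemma sum_const_nat_range a b (c : R) :
  \sum_(a <= r < b) c = (b - a)%:R * c.
Proof. by rewrite sumr_const_nat mulr_natl. Qed.

Lemma pair_value_ge0 s n p : descending s -> 0 <= pair_value s n p.
Proof. by case=> s0 _; rewrite addr_ge0. Qed.

Lemma sum_pairs s n q : (q <= n)%N ->
  \sum_(0 <= p < q) pair_value s n p = \sum_(n - q <= r < n + q) s r.
Proof.
elim: q => [|q IH] qn; first by rewrite big_geq // subn0 addn0 big_geq.
have qn' : (q <= n)%N by exact: ltnW.
rewrite big_nat_recr; last by [].
rewrite (IH qn') addnS.
rewrite [RHS]big_nat_recr; last by lia.
rewrite [in RHS]big_ltn; last by lia.
have -> : (n - q.+1).+1 = (n - q)%N by lia.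
rewrite /pair_value /=; ring.
Qed.

Lemma sum_all_pairs s n : 
  \sum_(0 <= p < n) pair_value s n p = \sum_(0 <= r < n.*2) s r.
Proof. by rewrite sum_pairs // subnn addnn. Qed.

(* For an unserved agent with threshold t, bag p costs at most [beta p] when
   taken by a lower agent and [beta p + gamma] when taken by one of the h higher
   agents; [sigma] is the slack of the bag that stays unfinished. *)
Definition budget t n h m s (beta : nat -> R) (gamma sigma : R) : Prop :=
  [/\ 0 <= gamma, 0 <= sigma,
    forall p, (p < n)%N -> t <= pair_value s n p ->
      pair_value s n p <= beta p + gamma,
    forall p, (p < n)%N -> pair_value s n p < t ->
      t + sigma <= beta p /\ t + s n.*2 <= beta p + gamma
    & \sum_(0 <= p < n) beta p + gamma * h%:R - sigma <=
      \sum_(0 <= r < m) s r].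

Definition ready t n h m s : Prop :=
  exists beta gamma sigma, budget t n h m s beta gamma sigma.

Lemma rank_invariant_ready t n h m s : 0 <= t -> (h < n)%N -> (n.*2 <= m)%N ->
  descending s -> rank_invariant t n h m s -> s 0%N < t -> ready t n h m s.
Proof.
move=> t0 hn nm ds J s0t; have [s0 sd] := ds.
have [/existsP[q0 Hq0]|/existsPn Hall] :=
    boolP [exists q : 'I_h.+1, pair_value s n q < t].
  have exq : exists q, (q <= h)%N && (pair_value s n q < t).
    by exists q0; rewrite Hq0 -ltnS ltn_ord.
  case: (ex_minnP exq) => q /andP[qh Hq] minq.
  have Hp p : (p < q)%N -> t <= pair_value s n p.
    move=> pq; rewrite leNgt; apply/negP => Hp.
    have := minq p; rewrite Hp andbT; lia.
  have half r : (n + q <= r)%N -> s r <= t / 2.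
    move=> nqr; have : s r <= s (n + q)%N by apply: sd.
    have : s (n + q)%N <= s (n - q.+1)%N by apply: sd; lia.
    by move: Hq; rewrite /pair_value; lra.
  (* With [gamma = t / 2] and [sigma = 0], the total required by [budget] is the invariant for
     [K = 0], the value of the [q] forced bags being added on both sides. *)
  pose beta p := if (p < q)%N then pair_value s n p - t / 2 else t.
  exists beta, (t / 2), 0; rewrite /beta.
  split=> //; first lra.
  - move=> p pn tp; case: (ltnP p q) => pq; first lra.
    have : s (n - p.+1)%N <= s 0%N by apply: sd.
    have : s (n + p)%N <= t / 2 by apply: half; lia.
    by rewrite /pair_value; lra.
  - move=> p pn pt; case: (ltnP p q) => pq; first by have := Hp p pq; lra.
    by have := half n.*2 ltac:(lia); lra.
  rewrite subr0 (@sum_nat_split _ _ 0 q n) //; last lia.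
  have -> : \sum_(0 <= p < q) beta p =
      \sum_(n - q <= r < n + q) s r - q%:R * (t / 2).
    rewrite -sum_pairs; last lia.
    rewrite -[X in X%:R * _]subn0 -sum_const_nat_range -sumrB.
    by apply: eq_big_nat => p /andP[_ pq]; rewrite /beta pq.
  have -> : \sum_(q <= p < n) beta p = (n%:R - q%:R) * t.
    rewrite -natrB -?sum_const_nat_range; last lia.
    by apply: eq_big_nat => p /andP[qp _]; rewrite /beta ltnNge qp.
  have := J 0%N q qh (fun r => ltac:(done)) s0t Hp Hq.
  rewrite (@sum_nat_split _ s 0 (n - q) m) //; last lia.
  rewrite (@sum_nat_split _ s (n - q) (n + q) m); try lia.
  by move=> JJ; lra.
(* The h.+1 middle bags all satisfy the agent, so one is left for it: a large
   gamma = G expresses this. *)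
have {}Hall p : (p <= h)%N -> t <= pair_value s n p.
  by rewrite -ltnS => ph; rewrite leNgt; exact: (Hall (Ordinal ph)).
pose G := \sum_(0 <= p < n) (pair_value s n p + t).
have pG p : (p < n)%N -> pair_value s n p + t <= G.
  move=> pn; rewrite /G big_mkord (bigD1 (Ordinal pn)) //= lerDl.
  by apply: sumr_ge0 => i _; rewrite addr_ge0 ?pair_value_ge0.
have G0 : 0 <= G.
  by apply: sumr_ge0 => i _; rewrite addr_ge0 ?pair_value_ge0.
have sG : s n.*2 <= G.
  have n0 : (0 < n)%N by lia.
  have : s n.*2 <= s (n + 0)%N by apply: sd; lia.
  by have := pG _ n0; have := s0 (n - 1)%N; rewrite {1}/pair_value; lra.
exists (fun p => pair_value s n p + t - (if (p <= h)%N then G else 0)), G, 0.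
split=> //.
- move=> p pn tp; case: ifP => _; first lra.
  by have := pG p pn; lra.
- move=> p pn pt; case: leqP => ph; first by have := Hall p ph; lra.
  by have := pair_value_ge0 n p ds; lra.
rewrite subr0 sumrB -/G (@sum_nat_split _ _ 0 h.+1 n) //.
rewrite [X in G - (X + _)](_ : _ = h.+1%:R * G); last first.
  rewrite -[X in X%:R * G]subn0 -sum_const_nat_range.
  by apply: eq_big_nat => p /andP[_]; rewrite ltnS => ->.
rewrite [X in G - (_ + X)]big_nat_cond big1; last first.
  by move=> p /andP[/andP[hp _] _]; rewrite leqNgt hp.
apply: (@le_trans _ _ 0); last by apply: sumr_ge0.
by rewrite -natr1; lra.
Qed.

End Ready.

(** * What bundles worth at most 1 imply for the bags *)

Section NormalConsequences.
Variable R : realFieldType.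
Implicit Types (s : nat -> R) (t : R).

Lemma sum_bundles s m (I : finType) (f : nat -> I) :
  \sum_b bundle s m f b = \sum_(0 <= r < m) s r.
Proof.
rewrite big_mkord [RHS](partition_big (fun r : 'I_m => f r) predT) //=.
Qed.

Section LargePair.
Variables (n m : nat) (s : nat -> R) (f : nat -> 'I_n) (p : nat).
Hypothesis sd : descending s.
Hypothesis f_le1 : forall b, bundle s m f b <= 1.
Hypotheses (nm : (n.*2 <= m)%N) (pn : (p < n)%N).

Lemma good_le1 r : (r < m)%N -> s r <= 1.
Proof.
move=> rm; apply: le_trans (f_le1 (f r)).
have := @sum_ge_uniq _ s m (fun r' => f r' == f r) [:: r].
by rewrite big_seq1 /= rm eqxx; apply=> //; case: sd.
Qed.

Lemma two_goods_le1 j k : (j < m)%N -> (k < m)%N -> j != k -> f j = f k ->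
  s j + s k <= 1.
Proof.
move=> jm km jk fjk; apply: le_trans (f_le1 (f j)).
have := @sum_ge_uniq _ s m (fun r' => f r' == f j) [:: j; k].
rewrite !big_cons big_nil addr0; apply; first by case: sd.
  by rewrite /= inE jk.
by rewrite /= jm km fjk eqxx.
Qed.

Lemma three_goods_le1 i j k : (i < m)%N -> (j < m)%N -> (k < m)%N ->
  i != j -> i != k -> j != k -> f i = f j -> f i = f k ->
  s i + s j + s k <= 1.
Proof.
move=> im jm km ij ik jk fij fik; apply: le_trans (f_le1 (f i)).
have := @sum_ge_uniq _ s m (fun r' => f r' == f i) [:: i; j; k].
rewrite !big_cons big_nil addr0 addrA; apply; first by case: sd.
  by rewrite /= !inE negb_or ij ik jk.
by rewrite /= im jm km -fij -fik eqxx.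
Qed.

Hypothesis p_gt1 : 1 < pair_value s n p.

(** Two such goods are worth at least bag [p], hence more than 1, and cannot share a bundle. *)
Lemma top_alone j k : (j < n - p)%N -> (k <= n + p)%N -> j != k -> f j != f k.
Proof.
move=> jn kn jk; apply/eqP => fjk; have [_ mono] := sd.
have := @two_goods_le1 j k ltac:(lia) ltac:(lia) jk fjk.
have : s (n - p.+1)%N <= s j by apply: mono; lia.
have : s (n + p)%N <= s k by apply: mono; lia.
by move: p_gt1; rewrite /pair_value; lra.
Qed.

Definition top_bundles := [set f j | j : 'I_n & (j < n - p)%N].

Lemma card_top_bundles : #|~: top_bundles| = p.
Proof.
have : #|top_bundles| = (n - p)%N.
  rewrite card_in_imset; last first.
    move=> j k; rewrite !inE => jn kn fjk; apply/eqP; apply: contraT => jk.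
    have := @top_alone j k jn ltac:(lia) jk; by rewrite fjk eqxx.
  rewrite cardsE -sum1_card.
  rewrite -(big_ord_widen n (fun _ => 1%N) (leq_subr p n)).
  by rewrite sum1_card card_ord.
by move=> E; rewrite cardsCs setCK card_ord E; lia.
Qed.

Lemma notin_top_bundles k : (n - p <= k <= n + p)%N -> f k \notin top_bundles.
Proof.
move=> /andP[kn knp]; apply/imsetP => -[j]; rewrite inE => jn fjk.
by have := @top_alone j k jn knp ltac:(lia); rewrite fjk eqxx.
Qed.

(** The [2p + 1] goods of ranks [n - p] to [n + p] avoid the top bundles, so three of them share one
    of the [p] others. *)
Lemma large_pair_small_good : 3 * s (n + p)%N <= 1.
Proof.
have [_ mono] := sd.
have [k kN||x [y [z [[xn xy yz zk] [fxy fyz]]]]] :=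
    @pigeonhole3 _ (~: top_bundles) f (n - p) p.*2.+1.
- by rewrite inE notin_top_bundles //; lia.
- by rewrite card_top_bundles; lia.
have := @three_goods_le1 x y z ltac:(lia) ltac:(lia) ltac:(lia) ltac:(lia)
  ltac:(lia) ltac:(lia) fxy (etrans fxy fyz).
have : s (n + p)%N <= s x by apply: mono; lia.
have : s (n + p)%N <= s y by apply: mono; lia.
have : s (n + p)%N <= s z by apply: mono; lia.
lra.
Qed.

End LargePair.

(** As [t * (n + h/2) = n], it suffices that each of the [K] goods and [q] bags takes at most [3t/2]
    from a total of at least [n]. Since [3t/2 >= 1], only a bag above 1 matters: its goods are below
    [t] and at most [1/3]. *)
Lemma rank_invariant_init t n h m s : (h < n)%N -> (n.*2 <= m)%N ->
  2 / 3 <= t -> t * (2 * n%:R + h%:R) = 2 * n%:R -> descending s ->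
  normal_partition n m s 0 -> rank_invariant t n h m s.
Proof.
move=> hn nm t23 tE sd [f [d [d0 fd dD]]] K q Kqh HK HKt Hp Hq.
have f_le1 b : bundle s m f b <= 1 by have := fd b; have := d0 b; lra.
have T : n%:R <= \sum_(0 <= r < m) s r.
  rewrite -(sum_bundles s m f).
  have : \sum_b (bundle s m f b + d b) = n%:R.
    by rewrite (eq_bigr _ (fun b _ => fd b)) sumr_const card_ord.
  by rewrite big_split /=; lra.
move: T; rewrite (@sum_nat_split _ s 0 K m) //; last lia.
rewrite (@sum_nat_split _ s K (n - q) m); try lia.
rewrite (@sum_nat_split _ s (n - q) (n + q) m); try lia.
have S1 : \sum_(0 <= r < K) s r <= (K - 0)%:R * 1.
  by apply: sum_nat_le => r rK; apply: (good_le1 sd f_le1); lia.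
have S2 : \sum_(n - q <= r < n + q) s r <= (q - 0)%:R * (3 / 2 * t).
  rewrite -sum_pairs; last lia.
  apply: sum_nat_le => p /andP[_ pq].
  have [p1|p1] := lerP (pair_value s n p) 1; first lra.
  have := @large_pair_small_good n m s f p sd f_le1 nm ltac:(lia) p1.
  have : s (n - p.+1)%N <= s K by case: sd => _; apply; lia.
  by rewrite /pair_value; lra.
move: S1 S2; rewrite !subn0 mulr1 => S1 S2 T.
have K0 : 0 <= K%:R :> R by [].
have X : 0 <= K%:R * (3 / 2 * t - 1) by rewrite mulr_ge0 //; lra.
lra.
Qed.

End NormalConsequences.

(** * Bounding the total excess of the bags above 1 *)

Section LargePairBound.
Variable R : realFieldType.
Variables (n m : nat) (s : nat -> R) (f : nat -> 'I_n) (p0 : 'I_n).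
Hypothesis sd : descending s.
Hypothesis f_le1 : forall b, bundle s m f b <= 1.
Hypothesis nm : (n.*2 <= m)%N.
Hypothesis p0_gt1 : 1 < pair_value s n p0.
Hypothesis p0_min : forall p, 1 < pair_value s n p -> (p0 <= p)%N.
Hypothesis s0_lt : s 0%N < 7 / 9.

Let w := s (n + p0)%N.

Let w_le : 3 * w <= 1.
Proof. exact: large_pair_small_good sd f_le1 nm (ltn_ord _) p0_gt1. Qed.

Let top_lt p : s (n - p.+1)%N < 7 / 9.
Proof. by apply: le_lt_trans s0_lt; case: sd => _; apply. Qed.

Let top_gt (p : nat) : (p0 <= p)%N -> 2 / 3 < s (n - p.+1)%N.
Proof.
move=> pp; have [_ mono] := sd.
have : s (n - p0.+1)%N <= s (n - p.+1)%N by apply: mono; lia.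
by move: p0_gt1 w_le; rewrite /pair_value /w; lra.
Qed.

(** As top goods are below [7/9], only bags of this range can exceed 1 from [p0] on; before [p0]
    none does. *)
Let in_range (p : 'I_n) := (p0 <= p)%N && (2 / 9 < s (n + p)%N).

Let meets_top (p : 'I_n) :=
  [exists q : 'I_n, (p0 <= q)%N && (f (n + p)%N == f (n - q.+1)%N)].

Let top_of (p : 'I_n) : 'I_n :=
  odflt p [pick q : 'I_n | (p0 <= q)%N && (f (n + p)%N == f (n - q.+1)%N)].

Let top_ofP p : meets_top p ->
  (p0 <= top_of p)%N /\ f (n + p)%N = f (n - (top_of p).+1)%N.
Proof.
rewrite /top_of => /existsP[q Hq]; case: pickP => [q' /andP[? /eqP ?] //|].
by move=> /(_ q); rewrite Hq.
Qed.

Let in_range_p0 : in_range p0.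
Proof.
rewrite /in_range leqnn /=; move: p0_gt1 (top_lt p0).
by rewrite /pair_value; lra.
Qed.

Let last_range := [arg max_(p > p0 | in_range p) (p : nat)].

(** Top goods gain value as the index grows, so [gap] is the least room beside a top good of the
    range, and at least the room beside those past the range. *)
Let gap := 1 - s (n - last_range.+1)%N.

Let gap_ge : 2 / 9 <= gap.
Proof. by have := top_lt last_range; rewrite /gap; lra. Qed.

Let gap_in p : in_range p -> gap <= 1 - s (n - p.+1)%N.
Proof.
rewrite /gap /last_range; case: arg_maxnP => // q _ maxq /maxq pq.
by rewrite lerD2l lerN2; case: sd => _; apply; move: (pq : (p <= q)%N); lia.
Qed.

Let gap_out (p : 'I_n) : (p0 <= p)%N -> ~~ in_range p ->
  1 - s (n - p.+1)%N <= gap.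
Proof.
rewrite /gap /last_range; case: arg_maxnP => // q /andP[p0q qr] _ pp pr.
rewrite lerD2l lerN2; case: sd => _; apply.
have [pq|qp] := leqP p q; last lia.
case/negP: pr; rewrite /in_range pp /=; apply: lt_le_trans qr _.
by case: sd => _; apply; lia.
Qed.

(* Each bundle of a top good holds at most one good of the range, as it would
   otherwise be worth more than 2/3 + 2/9 + 2/9; that good fits in the gap left
   by the top good. *)
Let range_matching :
  \sum_(p | in_range p && meets_top p) (s (n + p)%N - gap) <=
  \sum_(p | in_range p) (1 - s (n - p.+1)%N - gap).
Proof.
rewrite (partition_big top_of (fun q : 'I_n => (p0 <= q)%N)) /=; last first.
  by move=> p /andP[_ /top_ofP[]].
have -> : \sum_(p | in_range p) (1 - s (n - p.+1)%N - gap) =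
  \sum_(p : 'I_n | (p0 <= p)%N)
    (if in_range p then 1 - s (n - p.+1)%N - gap else 0).
  rewrite -big_mkcondr; apply: eq_bigl => p.
  by rewrite /in_range andbA andbb.
apply: ler_sum => q p0q.
case: (pickP (fun p => in_range p && meets_top p && (top_of p == q)));
  last first.
  move=> /(eq_bigl _) ->; rewrite big_pred0_eq.
  by case: ifP => // /gap_in gq; rewrite subr_ge0.
move=> p Hp; have pn := ltn_ord p; have qn := ltn_ord q.
rewrite (bigD1 p) //= big1 ?addr0.
  case/andP: Hp => /andP[pr /top_ofP[_ fp]] /eqP pq.
  have := @two_goods_le1 _ n m s f sd f_le1 (n + p)%N (n - q.+1)%N
    ltac:(lia) ltac:(lia) ltac:(lia); rewrite -pq => /(_ fp); rewrite pq => two.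
  by case: (boolP (in_range q)) => [_|/(gap_out p0q)]; lra.
move=> p' /andP[/andP[/andP[pr' /top_ofP[_ fp']] /eqP pq'] pp'].
case/andP: Hp => /andP[pr /top_ofP[_ fp]] /eqP pq.
have pn' := ltn_ord p'.
have pp : (p' : nat) <> p by move/val_inj => E; rewrite E eqxx in pp'.
have bounds : [/\ (n - q.+1 < m)%N, (n + p < m)%N, (n + p' < m)%N,
    n - q.+1 != n + p & n - q.+1 != n + p']%N.
  by split; clear -pn qn pn' nm; lia.
case: bounds => b1 b2 b3 b4 b5.
have b6 : (n + p)%N != (n + p')%N by clear -pp; lia.
have := @three_goods_le1 _ n m s f sd f_le1 _ _ _ b1 b2 b3 b4 b5 b6.
rewrite fp fp' pq pq' => /(_ erefl erefl).
case/andP: pr => _; case/andP: pr' => _; have := top_gt p0q.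
lra.
Qed.

(** An excess is the lower good minus the room beside the upper one. After subtracting [gap] from
    both, [range_matching] cancels the goods that meet a top good; for the others [gap >= 2/9]. *)
Let range_excess : \sum_(p | in_range p) (pair_value s n p - 1) <=
  \sum_(p | in_range p && ~~ meets_top p) (s (n + p)%N - 2 / 9).
Proof.
have -> : \sum_(p | in_range p) (pair_value s n p - 1) =
    \sum_(p | in_range p) (s (n + p)%N - gap) -
    \sum_(p | in_range p) (1 - s (n - p.+1)%N - gap).
  by rewrite -sumrB; apply: eq_bigr => p _; rewrite /pair_value; ring.
rewrite (bigID meets_top) /=.
have : \sum_(p | in_range p && ~~ meets_top p) (s (n + p)%N - gap) <=
    \sum_(p | in_range p && ~~ meets_top p) (s (n + p)%N - 2 / 9).
  by apply: ler_sum => p _; rewrite lerD2l lerN2.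
have := range_matching; lra.
Qed.

(** The [p0] bundles without top goods, worth at most 1 each, hold all bags before [p0] and the
    goods of the range that meet no top good. *)
Let other_bundles : \sum_(p < n | (p < p0)%N) pair_value s n p +
  \sum_(p | in_range p && ~~ meets_top p) s (n + p)%N <= p0%:R.
Proof.
set U := fun p => in_range p && ~~ meets_top p.
pose TB := top_bundles f p0.
have E : \sum_(r < m | f r \notin TB) s r = \sum_(b in ~: TB) bundle s m f b.
  rewrite (partition_big (fun r : 'I_m => f r) (fun b => b \in ~: TB)) /=;
    last by move=> r; rewrite inE.
  apply: eq_bigr => b bTB; apply: eq_bigl => r.
  by rewrite inE in bTB; case: eqVneq => [->|]; rewrite ?andbF // bTB.
have H : \sum_(r < m | f r \notin TB) s r <= p0%:R.
  rewrite E -[X in X%:R](card_top_bundles sd f_le1 nm (ltn_ord p0) p0_gt1).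
  rewrite -sumr_const; apply: ler_sum => b _; exact: f_le1.
apply: le_trans H.
pose l := iota (n - p0) p0.*2 ++ [seq (n + nat_of_ord p)%N | p <- enum U].
have -> : \sum_(p < n | (p < p0)%N) pair_value s n p +
  \sum_(p | U p) s (n + p)%N = \sum_(r <- l) s r.
  rewrite big_cat big_map /= big_enum /=; congr (_ + _).
  have p0n : (p0 <= n)%N by exact: ltnW.
  rewrite -(big_ord_widen n (pair_value s n) p0n).
  rewrite -(big_mkord xpredT (pair_value s n)) (sum_pairs s p0n) /index_iota.
  by have -> : (n + p0 - (n - p0) = p0.*2)%N by lia.
apply: (sum_ge_uniq (P := fun r => f r \notin TB)); first by case: sd.
  rewrite cat_uniq iota_uniq map_inj_uniq ?enum_uniq; last first.
    by move=> i j /addnI/val_inj.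
  rewrite andbT; apply/hasPn => r /mapP[p].
  rewrite mem_enum => /andP[/andP[pp _] _] ->; rewrite /= mem_iota.
  by have := ltn_ord p0; lia.
rewrite all_cat; apply/andP; split; apply/allP => r.
  rewrite mem_iota => rN; have := ltn_ord p0 => p0n.
  apply/andP; split; first lia.
  apply: (@notin_top_bundles _ n m s f p0) => //; lia.
case/mapP=> p; rewrite mem_enum => /andP[/andP[pp _] pU] ->.
apply/andP; split; first by have := ltn_ord p; lia.
apply: contra pU => /imsetP[j]; rewrite inE => jn fj.
apply/existsP; have qn : (n - j.+1 < n)%N by have := ltn_ord j; lia.
exists (Ordinal qn) => /=; apply/andP; split; first by lia.
by rewrite fj; apply/eqP; congr f; have := ltn_ord j; lia.
Qed.

Lemma large_pair_bound t : t <= 7 / 9 ->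
  \sum_(0 <= p < n)
    (if t <= pair_value s n p then pair_value s n p else 8 / 9) <= n%:R.
Proof.
move=> t79.
pose beta p : R := if t <= pair_value s n p then pair_value s n p else 8 / 9.
change (\sum_(0 <= p < n) beta p <= n%:R).
have -> : \sum_(0 <= p < n) beta p = \sum_(p < n) (beta p - 1) + n%:R.
  by rewrite big_mkord sumrB sumr_const card_ord subrK.
rewrite gerDr (bigID (fun p : 'I_n => (p < p0)%N)) /=.
pose U := fun p => in_range p && ~~ meets_top p.
(* [A] bounds the excess from [p0] on ([H1]). The bags before [p0] offset it in two ways: by [1/9]
   for each of the [a] small ones ([H2]), or through [other_bundles] ([H3]), where raising a small
   bag from at least [2 * w] to [8/9] is charged. *)
pose A := \sum_(p | U p) (s (n + p)%N - 2 / 9).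
pose u : R := \sum_(p | U p) 1.
have Aw : A <= u * (w - 2 / 9).
  rewrite /u mulr_suml; apply: ler_sum => p /andP[/andP[pp _] _].
  by rewrite mul1r lerD2r; case: sd => _; apply; rewrite leq_add2l.
have H1 : \sum_(p < n | ~~ (p < p0)%N) (beta p - 1) <= A.
  apply: le_trans range_excess.
  have -> : \sum_(p | in_range p) (pair_value s n p - 1) =
    \sum_(p : 'I_n | ~~ (p < p0)%N)
      (if in_range p then pair_value s n p - 1 else 0).
    rewrite -big_mkcondr; apply: eq_bigl => p.
    by rewrite /in_range -leqNgt andbA andbb.
  apply: ler_sum => p; rewrite -leqNgt => pp.
  have tg := top_gt pp; have tl := top_lt p.
  rewrite /beta; case: (boolP (in_range p)); rewrite /in_range pp /=.
    by move=> ?; case: ifP; rewrite /pair_value; lra.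
  by rewrite -leNgt => ?; case: ifP; rewrite /pair_value; lra.
pose small (p : 'I_n) := (p < p0)%N && ~~ (t <= pair_value s n p).
pose a : R := \sum_(p < n | small p) 1.
have aE c : a * c = \sum_(p < n | (p < p0)%N)
    (if ~~ (t <= pair_value s n p) then c else 0).
  by rewrite /a mulr_suml -big_mkcondr; apply: eq_bigr => p _; rewrite mul1r.
have H2 : \sum_(p < n | (p < p0)%N) (beta p - 1) <= - (a * (1 / 9)).
  rewrite aE -sumrN; apply: ler_sum => p pp; rewrite /beta.
  case: ifP => /= _; last lra.
  by rewrite oppr0 subr_le0 leNgt; apply/negP => /p0_min; rewrite leqNgt pp.
have H3 : \sum_(p < n | (p < p0)%N) (beta p - 1) <=
    - (A + u * (2 / 9)) + a * (8 / 9 - 2 * w).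
  have -> : A + u * (2 / 9) = \sum_(p | U p) s (n + p)%N.
    by rewrite /A /u mulr_suml -big_split; apply: eq_bigr => q _ /=; ring.
  have P : \sum_(p < n | (p < p0)%N) (1 : R) = p0%:R.
    rewrite -(big_ord_widen n (fun _ => 1 : R) (ltnW (ltn_ord p0))).
    by rewrite sumr_const card_ord.
  have : \sum_(p < n | (p < p0)%N) (beta p - 1) <=
    \sum_(p < n | (p < p0)%N) (pair_value s n p +
      (if ~~ (t <= pair_value s n p) then 8 / 9 - 2 * w else 0) - 1).
    apply: ler_sum => q qp; rewrite /beta lerD2r.
    have w1 : w <= s (n + q)%N by case: sd => _; apply; rewrite leq_add2l ltnW.
    have w2 : w <= s (n - q.+1)%N.
      by case: sd => _; apply; rewrite (leq_trans (leq_subr _ _)) ?leq_addr.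
    by case: ifP => /= _; rewrite /pair_value; lra.
  rewrite [leRHS]sumrB [in leRHS]big_split /= -aE P.
  by have := other_bundles; rewrite -/U; lra.
have u0 : 0 <= u by exact: sumr_ge0.
have a0 : 0 <= a by exact: sumr_ge0.
have wg : 2 / 9 < w by have /andP[] := in_range_p0.
(* In the first case [H1] and [H3] suffice; in the second, [u] is so small against [a] that [H2]
   covers [A]. *)
have [c1|c2] := lerP (a * (8 / 9 - 2 * w)) (u * (2 / 9)); first lra.
have X1 : u * (w - 2 / 9) <= a * (4 - 9 * w) * (w - 2 / 9).
  by rewrite ler_pM2r; lra.
(* H2 and H3 cover all cases as (4 - 9w)(9w - 2) = 1 - (9w - 3)^2. *)
have X2 : 0 <= a * (1 - 3 * w) ^+ 2 by rewrite mulr_ge0 ?sqr_ge0.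
have : a * (4 - 9 * w) * (w - 2 / 9) = a * (1 / 9) - a * (1 - 3 * w) ^+ 2.
  by field.
lra.
Qed.

End LargePairBound.

(** * The two kinds of agents under the reductions *)

Section Agents.
Variable R : realFieldType.
Implicit Types (s : nat -> R) (t : R).

(* The thresholds 3/4 + 1/(12 n0) are 3/4 (1 + e) for e = 1/(9 n0), n0 being the
   initial number of agents.  Only the reduction {0, 2n} costs dummy value, at
   most e, so the total stays below n0 * e = 1/9. *)
Definition nearly_normal_partition t n m s : Prop :=
  exists e D : R, [/\ 0 <= e, 27 * e <= 1, t = 3 / 4 * (1 + e),
    D + n%:R * e <= 1 / 9 & normal_partition n m s D].

Lemma nearly_normal_ready t n h m s : (n.*2.+2 <= m)%N -> descending s ->
  nearly_normal_partition t n.+1 m s -> s 0%N < t ->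
  s n.*2 + s n.*2.+1 + s n.*2.+2 < t -> s 0%N + s n.*2.+2 < t ->
  ready t n.+1 h m s.
Proof.
move=> nm sd [e [D [e0 e27 tE De [f [d [d0 fd dD]]]]]] s0t s3t s4t.
have [s_ge0 mono] := sd.
have f_le1 b : bundle s m f b <= 1 by have := fd b; have := d0 b; lra.
have T : n.+1%:R - D <= \sum_(0 <= r < m) s r.
  rewrite -(sum_bundles s m f).
  have : \sum_b (bundle s m f b + d b) = n.+1%:R.
    by rewrite (eq_bigr _ (fun b _ => fd b)) sumr_const card_ord.
  by rewrite big_split /=; lra.
have x3 : 3 * s n.*2.+2 <= t.
  have : s n.*2.+2 <= s n.*2.+1 by apply: mono.
  have : s n.*2.+2 <= s n.*2 by apply: mono; rewrite leqW.
  lra.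
have t79 : t <= 7 / 9 by lra.
have n0 : 0 <= n%:R :> R by [].
have ne0 : 0 <= n%:R * e by rewrite mulr_ge0.
have [/existsP[q0 Hq0]|/existsPn Hall] :=
    boolP [exists q : 'I_n.+1, 1 < pair_value s n.+1 q]; last first.
  (* Goods outside the bags are at most [t / 3], so a filled bag costs at most [4t/3 = 1 + e]. The
     slack [sigma] is [t / 3], more than the [1/9] that bounds [D + n.+1 * e]. *)
  exists (fun=> 1 + e), 0, (1 + e - t); split=> //; first lra.
  - move=> p pn _; have := Hall (Ordinal pn); rewrite -leNgt /=; lra.
  - by move=> p pn _; rewrite doubleS; lra.
  rewrite sum_const_nat_range subn0 mul0r addr0.
  by move: T De; rewrite -natr1; lra.
have exq : exists q, 1 < pair_value s n.+1 q by exists q0.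
case: (ex_minnP exq) => q Hq minq.
have qn : (q < n.+1)%N by apply: leq_ltn_trans (minq _ Hq0) (ltn_ord _).
have B : \sum_(0 <= p < n.+1) (if t <= pair_value s n.+1 p
    then pair_value s n.+1 p else 8 / 9) <= n.+1%:R.
  apply: (@large_pair_bound _ n.+1 m s f (Ordinal qn)) => //; lra.
have s0q : 2 / 3 < s 0%N.
  have := @large_pair_small_good _ n.+1 m s f q sd f_le1 nm qn Hq.
  have : s (n.+1 - q.+1)%N <= s 0%N by apply: mono.
  by move: Hq; rewrite /pair_value; lra.
(* As [s 0 > 2/3] and [s 0 + s n.*2.+2 < t <= 7/9], goods outside the bags are below [1/9] and a
   filled bag costs at most [8/9]; [sigma = 1/9] covers [D]. *)
exists (fun p =>
  if t <= pair_value s n.+1 p then pair_value s n.+1 p else 8 / 9).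
exists 0, (1 / 9); split=> //; first lra.
- by move=> p pn ->; rewrite addr0.
- by move=> p pn; rewrite ltNge => /negbTE->; rewrite doubleS; lra.
move: De; rewrite mul0r -natr1; lra.
Qed.

(** The alternatives match the two terms of the maximum in [tau]. *)
Definition agent t n h m s : Prop := descending s /\
  ((2 / 3 <= t /\ rank_invariant t n h m s) \/ nearly_normal_partition t n m s).

Lemma agent_ready t n h m s : (h < n.+1)%N -> (n.*2.+2 <= m)%N ->
  agent t n.+1 h m s -> s 0%N < t ->
  s n.*2 + s n.*2.+1 + s n.*2.+2 < t -> s 0%N + s n.*2.+2 < t ->
  ready t n.+1 h m s.
Proof.
move=> hn nm [sd [[t23 J]|N]] s0t s3t s4t; last exact: nearly_normal_ready.
by apply: rank_invariant_ready; rewrite ?doubleS //; lra.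
Qed.

Lemma nearly_normal_step t n m s' e D : 0 <= e -> 27 * e <= 1 ->
  t = 3 / 4 * (1 + e) -> D + n%:R * e <= 1 / 9 -> descending s' ->
  covering_partition n m s' D ->
  exists s'', [/\ forall r, s'' r <= s' r, descending s'' &
    nearly_normal_partition t n m s''].
Proof.
move=> e0 e27 tE De sd' /(normalize sd')[s'' [sd'' le'' N]].
by exists s''; split=> //; exists e, D.
Qed.

Lemma agent_remove_top t n h h' m s : (h' < n)%N -> (n.*2 <= m)%N ->
  agent t n.+1 h m.+1 s -> (s 0%N < t /\ h' = h) \/ h = h'.+1 ->
  exists s', (forall r, s' r <= del 0 s r) /\ agent t n h' m s'.
Proof.
move=> h'n nm [sd [[t23 J]|[e [D [e0 e27 tE De N]]]]] hh'.
  exists (del 0 s); split=> //; split; first exact: descending_del.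
  left; split=> //; apply: rank_invariant_remove_top J hh' => //; lra.
case: n h'n nm De N => // n h'n nm De N.
have [|s' [le' sd' N']] := nearly_normal_step e0 e27 tE _ (descending_del 0 sd)
  (covering_remove_top sd N).
  by move: De; rewrite -[n.+2%:R]natr1; lra.
by exists s'; split=> //; split=> //; right.
Qed.

(** For the second kind, the departing agent frees [e] of the dummy budget, which pays for the
    merge: [s 0 < t] and the other good is at most [t / 3], while [4t/3 = 1 + e]. *)
Lemma agent_remove_pair t n h h' m s : (h' < n)%N -> (n.*2 < m)%N ->
  agent t n.+1 h m.+2 s -> s 0%N < t ->
  s n.*2 + s n.*2.+1 + s n.*2.+2 < t ->
  (s 0%N + s n.*2.+2 < t /\ h' = h) \/ h = h'.+1 ->
  exists s', (forall r, s' r <= del n.*2.+1 (del 0 s) r) /\ agent t n h' m s'.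
Proof.
move=> h'n nm [sd [[t23 J]|[e [D [e0 e27 tE De N]]]]] s0t s3t hh'.
  exists (del n.*2.+1 (del 0 s)); split=> //; split.
    by do 2!apply: descending_del.
  by left; split=> //; apply: rank_invariant_remove_pair J s0t hh' => //; lra.
case: n h'n nm De N s3t {hh'} => // n h'n nm De N s3t.
have se : s 0%N + s n.*2.+4 <= 1 + e.
  have [_ mono] := sd.
  have : s n.+1.*2.+2 <= s n.+1.*2.+1 by apply: mono.
  have : s n.+1.*2.+2 <= s n.+1.*2 by apply: mono; rewrite leqW.
  by move: s3t; rewrite doubleS; lra.
have [||s' [le' sd' N']] := nearly_normal_step e0 e27 tE _
  (descending_del n.*2.+3 (descending_del 0 sd))
  (covering_remove_pair _ sd N e0 se).
- by move: De; rewrite -[n.+2%:R]natr1; lra.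
- by clear -nm; lia.
by exists s'; split=> //; split=> //; right.
Qed.

Lemma agent_remove_triple t n h h' m s : (h' < n)%N -> (n.*2 <= m)%N ->
  agent t n.+1 h m.+3 s -> s 0%N < t ->
  (s n.*2 + s n.*2.+1 + s n.*2.+2 < t /\ h' = h) \/ h = h'.+1 ->
  exists s', (forall r, s' r <= del n.*2 (del n.*2 (del n.*2 s)) r) /\
    agent t n h' m s'.
Proof.
move=> h'n nm [sd [[t23 J]|[e [D [e0 e27 tE De N]]]]] s0t hh'.
  exists (del n.*2 (del n.*2 (del n.*2 s))); split=> //; split.
    by do 3!apply: descending_del.
  by left; split=> //; apply: rank_invariant_remove_triple J s0t hh' => //; lra.
case: n h'n nm De N {hh'} => // n h'n nm De N.
have sd3 : descending (del n.+1.*2 (del n.+1.*2 (del n.+1.*2 s))).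
  by do 3!apply: descending_del.
have [||s' [le' sd' N']] := nearly_normal_step e0 e27 tE _ sd3
  (covering_remove_triple _ sd N).
- by move: De; rewrite -[n.+2%:R]natr1; lra.
- by clear -nm; lia.
by exists s'; split=> //; split=> //; right.
Qed.

End Agents.

(** * Bag filling with priorities *)

Section BagFilling.
Variables (R : realFieldType) (n : nat) (T Bag : finType).
Variables (v : 'I_n -> T -> R) (t : 'I_n -> R).
Hypothesis v_ge0 : forall i g, 0 <= v i g.

Definition num_higher (N : {set 'I_n}) (i : 'I_n) : nat :=
  #|[set j in N | (j < i)%N]|.

Lemma higher_setD1 (N : {set 'I_n}) r i : r \in N ->
  num_higher N i = ((r < i)%N + num_higher (N :\ r) i)%N.
Proof.
move=> rN; rewrite /num_higher (cardsD1 r) inE rN /=; congr (_ + _)%N.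
by apply: eq_card => j; rewrite !inE andbA.
Qed.

Definition content (F : T -> option Bag) (k : Bag) (i : 'I_n) : R :=
  \sum_(g | F g == Some k) v i g.

(** Induction on the agents plus the loose goods, those with [F g = None]. The highest agent
    satisfied by some bag takes it: to agents above, it is worth less than their threshold and
    [beta] covers it; to agents below, at most [beta + gamma], with one higher agent fewer. If no
    bag satisfies anyone, a loose good, worth at most [x], enters a bag. *)
Lemma bag_filling (N : {set 'I_n}) (K : {set Bag}) (F : T -> option Bag)
    (beta : 'I_n -> Bag -> R) (x gamma sigma : 'I_n -> R) (k0 : Bag) :
  #|N| = #|K| ->
  (forall i, i \in N -> 0 <= gamma i /\ 0 <= sigma i) ->
  (forall i g, i \in N -> F g = None -> v i g <= x i) ->
  (forall i k, i \in N -> k \in K -> content F k i <= beta i k + gamma i) ->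
  (forall i k, i \in N -> k \in K -> content F k i < t i ->
    t i + sigma i <= beta i k /\ t i + x i <= beta i k + gamma i) ->
  (forall i, i \in N ->
    \sum_(k in K) beta i k + gamma i * (num_higher N i)%:R - sigma i <=
    \sum_(g | F g == None) v i g + \sum_(k in K) content F k i) ->
  exists (F' : T -> Bag) (b : 'I_n -> Bag),
    [/\ forall g k, F g = Some k -> F' g = k,
        {in N &, injective b}, forall i, i \in N -> b i \in K &
        forall i, i \in N -> t i <= \sum_(g | F' g == b i) v i g].
Proof.
have [c] := ubnPleq (#|N| + #|[set g | F g == None]|)%N.
elim: c N K F => [|c IH] N K F.
  rewrite leqn0 addn_eq0 cards_eq0 => /andP[/eqP-> _] _ _ _ _ _ _.
  exists (fun g => odflt k0 (F g)), (fun=> k0).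
  by split=> [g k ->|i|i|i]; rewrite ?inE.
move=> Nc NK gs vx Hcap Hlow Htot.
have [N0|[j jN]] := set_0Vmem N.
  subst N; exists (fun g => odflt k0 (F g)), (fun=> k0).
  by split=> [g k ->|i|i|i]; rewrite ?inE.
have [/existsP[k /existsP[i1 /and3P[kK i1N ti1]]]|nosat] := boolP
    [exists k, exists i, [&& k \in K, i \in N & t i <= content F k i]].
  pose sat := [pred i | (i \in N) && (t i <= content F k i)].
  have sat1 : sat i1 by rewrite /= i1N.
  case: (@arg_minnP _ i1 sat (fun i => i : nat) sat1) => r /andP[rN tr] minr.
  have sub i : i \in N :\ r -> i \in N by rewrite inE => /andP[].
  have subK k' : k' \in K :\ k -> k' \in K by rewrite inE => /andP[].
  have [|||||||F' [b [FF' binj bK tb]]] := IH (N :\ r) (K :\ k) F.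
  - by move: Nc; rewrite (cardsD1 r N) rN add1n addSn ltnS.
  - by have := NK; rewrite (cardsD1 r N) rN (cardsD1 k K) kK !add1n => -[].
  - by move=> i /sub; apply: gs.
  - by move=> i g /sub; apply: vx.
  - by move=> i k' /sub iN /subK; apply: Hcap.
  - by move=> i k' /sub iN /subK; apply: Hlow.
  - move=> i iNr; have iN := sub _ iNr; have := Htot i iN.
    rewrite (bigD1 k kK) [X in _ <= _ + X -> _](bigD1 k kK) /=.
    have E G : \sum_(k' in K :\ k) G k' = \sum_(k' in K | k' != k) G k' :> R.
      by apply: eq_bigl => k'; rewrite !inE andbC.
    rewrite !E (higher_setD1 i rN); have [g0 s0] := gs i iN.
    case: ltngtP => [ri|ir|/val_inj ri]; last first.
    + by move: iNr; rewrite ri !inE eqxx.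
    + have ct : content F k i < t i.
        rewrite ltNge; apply/negP => cti.
        by have := minr i; rewrite /= iN cti => /(_ isT); rewrite leqNgt ir.
      by have [? _] := Hlow i k iN kK ct; rewrite add0n; lra.
    + by have := Hcap i k iN kK; rewrite add1n -natr1; lra.
  exists F', (fun i => if i == r then k else b i); split=> //.
  + move=> i j' iN j'N /=; case: eqVneq => [->|ir]; case: eqVneq => [->//|jr].
    * by move=> kb; have := bK j'; rewrite !inE jr j'N -kb eqxx => /(_ isT).
    * by move=> bk; have := bK i; rewrite !inE ir iN bk eqxx => /(_ isT).
    * by apply: binj; rewrite !inE ?ir ?jr.
  + move=> i iN; case: eqVneq => // ir.
    by apply: subK; apply: bK; rewrite !inE ir.
  + move=> i iN; case: eqVneq => [->|ir]; last by apply: tb; rewrite !inE ir.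
    apply: le_trans tr _; rewrite /content.
    rewrite [leRHS](bigID (fun g => F g == Some k)) /=.
    rewrite (eq_bigl (fun g => (F' g == k) && (F g == Some k))); last first.
      by move=> g; case: eqVneq => [/FF'->|]; rewrite ?eqxx ?andbF.
    by rewrite lerDl; apply: sumr_ge0.
have {}nosat i k : i \in N -> k \in K -> content F k i < t i.
  move=> iN kK; rewrite ltNge; apply: contra nosat => ti.
  by apply/existsP; exists k; apply/existsP; exists i; rewrite kK iN.
have [k kK] : exists k, k \in K.
  by apply/card_gt0P; rewrite -NK; apply/card_gt0P; exists j.
have [/set0Pn[u]|/negPn/eqP U0] := boolP ([set g | F g == None] != set0).
  rewrite inE => /eqP Fu.
  pose F1 g := if g == u then Some k else F g.
  have F1c k' i : content F1 k' i =
      content F k' i + (if k' == k then v i u else 0).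
    rewrite /content (bigID (fun g => g == u)) /= addrC; congr (_ + _).
      apply: eq_bigl => g; rewrite /F1; case: (eqVneq g u) => [->|_].
        by rewrite Fu andbF.
      by rewrite andbT.
    case: ifP => kk.
      by apply: big_pred1 => g; rewrite /F1 /=; case: (eqVneq g u) => [_|_];
        rewrite ?andbF // andbT (eqP kk) eqxx.
    apply: big_pred0 => g; rewrite /F1.
    case: (eqVneq g u); rewrite ?andbF // andbT.
    by move=> _; apply/eqP => -[kk']; rewrite kk' eqxx in kk.
  have F1N g : (F1 g == None) = (F g == None) && (g != u).
    by rewrite /F1; case: (eqVneq g u); rewrite ?andbF // andbT.
  have [|||||F' [b [FF' binj bK tb]]] := IH N K F1 _ NK gs.
  - have : (#|[set g | F1 g == None]| < #|[set g | F g == None]|)%N.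
      apply: proper_card; apply/properP; split.
        by apply/subsetP => g; rewrite !inE F1N => /andP[].
      by exists u; rewrite !inE ?F1N ?Fu ?eqxx.
    by move: Nc; lia.
  - move=> i g iN /eqP; rewrite F1N => /andP[/eqP Fg _]; exact: vx.
  - move=> i k' iN k'K; rewrite F1c; case: eqP => _; last first.
      by rewrite addr0 Hcap.
    have ct := nosat i k' iN k'K.
    by have [_] := Hlow i k' iN k'K ct; have := vx i u iN Fu; lra.
  - by move=> i k' iN k'K _; apply: Hlow => //; apply: nosat.
  - move=> i iN; have := Htot i iN.
    under [X in _ -> _ <= _ + X]eq_bigr do rewrite F1c.
    have -> : \sum_(k' in K) (content F k' i + (if k' == k then v i u else 0)) =
        \sum_(k' in K) content F k' i + v i u.
      rewrite big_split /=; congr (_ + _); rewrite (bigD1 k kK) /= eqxx.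
      by rewrite big1 ?addr0 // => k' /andP[_ /negbTE->].
    rewrite [X in _ <= X + _ -> _](bigD1 u) /= ?Fu //.
    by rewrite (eq_bigl _ _ F1N); lra.
  exists F', b; split=> // g k' Fg; apply: FF'.
  by rewrite /F1; case: (eqVneq g u) => // gu; rewrite gu Fu in Fg.
(* No good is loose and all bags are below [t j], so they total less than [#|K|] times [t j],
   against the budget; as [K] is nonempty, [sigma j] is absorbed. *)
have := Htot j jN; rewrite [X in _ <= X + _]big_pred0; last first.
  by move=> g; have := in_set0 g; rewrite -U0 inE.
rewrite add0r leNgt => /negP[].
have [g0 s0] := gs j jN.
have X1 : \sum_(k in K) content F k j < \sum_(k in K) t j.
  apply: ltr_sum => [|k' k'K]; last exact: nosat.
  by apply/hasP; exists k; rewrite ?mem_index_enum.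
have X2 : \sum_(k in K) (t j + sigma j) <= \sum_(k in K) beta j k.
  by apply: ler_sum => k' k'K; have [] := Hlow j k' jN k'K (nosat _ _ jN k'K).
have X3 : \sum_(k in K) sigma j >= sigma j.
  by rewrite (bigD1 k) //= lerDl sumr_ge0.
have X4 : 0 <= gamma j * (num_higher N j)%:R by rewrite mulr_ge0.
by move: X2; rewrite big_split /=; lra.
Qed.

End BagFilling.

(** * Serving the highest satisfied agent *)

Section PriorityAllocation.
Variables (R : realFieldType) (n : nat) (t : 'I_n -> R).
Implicit Types (N : {set 'I_n}) (s : 'I_n -> nat -> R).

Lemma higher_lt N i : i \in N -> (num_higher N i < #|N|)%N.
Proof.
move=> iN; apply: proper_card; apply/properP; split.
  by apply/subsetP => j; rewrite inE => /andP[].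
by exists i; rewrite // inE ltnn andbF.
Qed.

(** The least satisfied index is served: agents above it fall short of their threshold, agents below
    it lose a higher agent. *)
Lemma choose_recipient N (val : 'I_n -> R) i : i \in N -> t i <= val i ->
  exists2 r, r \in N & t r <= val r /\
    forall j, j \in N :\ r -> (num_higher (N :\ r) j < #|N :\ r|)%N /\
      ((val j < t j /\ num_higher (N :\ r) j = num_higher N j) \/
      num_higher N j = (num_higher (N :\ r) j).+1).
Proof.
move=> iN ti; pose sat := [pred j | (j \in N) && (t j <= val j)].
have sati : sat i by rewrite /= iN.
case: (@arg_minnP _ i sat (fun j => j : nat) sati) => r /andP[rN tr] minr.
exists r => //; split=> // j jNr; split; first exact: higher_lt.
have /andP[jr jN] : (j != r) && (j \in N) by rewrite !inE in jNr.
rewrite (higher_setD1 j rN).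
case: ltngtP => [rj|rj|/val_inj rj]; last by rewrite rj eqxx in jr.
  by right; rewrite add1n.
left; split; last by rewrite add0n.
rewrite ltNge; apply/negP => tj.
by have := minr j; rewrite /= jN tj => /(_ isT); rewrite leqNgt rj.
Qed.

Lemma allocate_bags k N m s (i0 : 'I_n) : #|N| = k.+1 -> (k.*2.+2 <= m.+1)%N ->
  (forall i, i \in N -> descending (s i)) ->
  (forall i, i \in N -> ready (t i) k.+1 (num_higher N i) m.+1 (s i)) ->
  exists a : nat -> 'I_n, forall i, i \in N ->
    t i <= \sum_(r < m.+1 | a r == i) s i r.
Proof.
move=> Nk km sd rd.
pose v i (g : 'I_m.+1) : R := if i \in N then s i g else 0.
have v0 i g : 0 <= v i g.
  by rewrite /v; case: ifP => // /sd[].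
have /fin_all_exists[w Hw] : forall i, exists w : (nat -> R) * R * R,
    i \in N -> budget (t i) k.+1 (num_higher N i) m.+1 (s i) w.1.1 w.1.2 w.2.
  move=> i; have [iN|iN] := boolP (i \in N); last by exists (fun=> 0, 0, 0).
  by have [beta [gamma [sigma H]]] := rd i iN; exists (beta, gamma, sigma).
pose F (g : 'I_m.+1) : option 'I_k.+1 :=
  if (g < k.+1)%N then Some (inord (k - g)%N)
  else if (g < k.+1.*2)%N then Some (inord (g - k.+1)%N) else None.
have FN g : (F g == None) = (k.+1.*2 <= g)%N.
  rewrite /F; case: (ltnP g k.+1) => gk; last by case: (ltnP g k.+1.*2).
  by apply/esym/negbTE; rewrite -ltnNge; lia.
have FS (g : 'I_m.+1) (p : 'I_k.+1) : (F g == Some p) =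
    (g == inord (k.+1 - p.+1)%N) || (g == inord (k.+1 + p)%N).
  have pk := ltn_ord p.
  have e1 : (g == inord (k.+1 - p.+1)%N) = (g == (k.+1 - p.+1)%N :> nat).
    by rewrite -val_eqE /= inordK //; lia.
  have e2 : (g == inord (k.+1 + p)%N) = (g == (k.+1 + p)%N :> nat).
    by rewrite -val_eqE /= inordK //; lia.
  rewrite e1 e2 /F; case: (ltnP g k.+1) => gk.
    rewrite (inj_eq Some_inj) -val_eqE /= inordK; lia.
  case: (ltnP g k.+1.*2) => gk2; last by apply/esym/negbTE; lia.
  rewrite (inj_eq Some_inj) -val_eqE /= inordK; lia.
have cF i p : i \in N -> content v F p i = pair_value (s i) k.+1 p.
  move=> iN; have pk := ltn_ord p.
  have ne : inord (k.+1 + p)%N != inord (k.+1 - p.+1)%N :> 'I_m.+1.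
    by rewrite -val_eqE /= !inordK; lia.
  rewrite /content (eq_bigl _ _ (FS ^~ p)).
  rewrite (bigD1 (inord (k.+1 - p.+1)%N)) /=; last by rewrite eqxx.
  rewrite (bigD1 (inord (k.+1 + p)%N)) /=; last by rewrite eqxx orbT.
  rewrite big_pred0 ?addr0; last first.
    by move=> g; case: eqVneq => //= _; case: eqVneq.
  by rewrite /v iN /pair_value !inordK //; lia.
have [||||||F' [b [FF' binj _ tb]]] := @bag_filling R n 'I_m.+1 'I_k.+1 v t v0
  N [set: 'I_k.+1] F (fun i p => (w i).1.1 p) (fun i => s i k.+1.*2)
  (fun i => (w i).1.2) (fun i => (w i).2) ord0.
- by rewrite cardsT card_ord.
- by move=> i /Hw[].
- move=> i g iN /eqP; rewrite FN /v iN => kg; by have [_] := sd i iN; apply.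
- move=> i p iN _; rewrite cF //; have [g0 s0 H1 H2 _] := Hw i iN.
  have [tp|tp] := lerP (t i) (pair_value (s i) k.+1 p); first exact: H1.
  have [_ H3] := H2 p (ltn_ord p) tp; apply: le_trans H3.
  have [si0 _] := sd i iN; have := si0 k.+1.*2; lra.
- move=> i p iN _; rewrite cF // => tp.
  by have [_ _ _ H2 _] := Hw i iN; apply: H2.
- move=> i iN; have [_ _ _ _] := Hw i iN.
  have -> : \sum_(p in [set: 'I_k.+1]) (w i).1.1 p =
      \sum_(0 <= p < k.+1) (w i).1.1 p.
    by rewrite big_mkord; apply: eq_bigl => p; rewrite inE.
  move=> /le_trans; apply.
  have -> : \sum_(p in [set: 'I_k.+1]) content v F p i =
      \sum_(0 <= r < k.+1.*2) s i r.
    rewrite -sum_all_pairs big_mkord; apply: eq_big => p; rewrite ?inE // => _.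
    exact: cF.
  rewrite (sum_nat_split (s i) (leq0n k.+1.*2) km) addrC lerD2r.
  rewrite big_geq_mkord /= le_eqVlt; apply/orP; left; apply/eqP.
  by apply: eq_big => g; rewrite ?FN // /v iN.
exists (fun r => odflt i0 [pick i | (i \in N) && (b i == F' (inord r))]).
move=> i iN; apply: le_trans (tb i iN) _.
rewrite /v iN; rewrite [leLHS]big_mkcond [leRHS]big_mkcond /=.
apply: ler_sum => g _; rewrite inord_val.
case: pickP => [j /andP[jN /eqP bj]|no] /=.
  case: eqVneq => [bi|]; last by case: ifP => // _; have [] := sd i iN.
  by rewrite (binj j i) ?eqxx // bj bi.
case: eqVneq => [bi|]; last by case: ifP => // _; have [] := sd i iN.
by have := no i; rewrite iN bi eqxx.
Qed.

End PriorityAllocation.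

(** * Induction on the number of agents *)

Section Induction.
Variables (R : realFieldType) (n : nat) (t : 'I_n -> R) (i0 : 'I_n).
Implicit Types (N : {set 'I_n}) (s : 'I_n -> nat -> R).

Definition ordered_instance k N m s : Prop := #|N| = k /\
  forall i, i \in N -> agent (t i) k (num_higher N i) m (s i).

Definition has_allocation N m s : Prop := exists a : nat -> 'I_n,
  forall i, i \in N -> t i <= \sum_(r < m | a r == i) s i r.

(* A reduction gives a fixed set of ranks to the agent r; [red] maps the values
   of an agent to those of the remaining ranks, [val] is the value given
   away. *)
Lemma solve_reduced k N m m' s r (red : (nat -> R) -> nat -> R)
    (val : (nat -> R) -> R) :
  (forall a' : nat -> 'I_n, exists a : nat -> 'I_n, forall i (u : nat -> R),
    \sum_(q < m | a q == i) u q =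
    (if i == r then val u else 0) + \sum_(q < m' | a' q == i) red u q) ->
  (forall s', ordered_instance k (N :\ r) m' s' ->
    has_allocation (N :\ r) m' s') ->
  #|N| = k.+1 -> r \in N -> t r <= val (s r) ->
  (forall q, 0 <= red (s r) q) ->
  (forall j, j \in N :\ r -> exists u : nat -> R,
    (forall q, u q <= red (s j) q) /\
    agent (t j) k (num_higher (N :\ r) j) m' u) ->
  has_allocation N m s.
Proof.
move=> assign solve Nk rN tr red0 step.
have /fin_all_exists[s' Hs'] : forall j, exists u : nat -> R, j \in N :\ r ->
    (forall q, u q <= red (s j) q) /\
    agent (t j) k (num_higher (N :\ r) j) m' u.
  move=> j; have [jN|jN] := boolP (j \in N :\ r); last by exists (fun=> 0).
  by have [u Hu] := step j jN; exists u.
have [|a' Ha'] := solve s'.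
  split; first by have := Nk; rewrite (cardsD1 r) rN add1n => -[].
  by move=> i /Hs'[].
have [a Ha] := assign a'; exists a => i iN; rewrite Ha.
have [->|ir] := eqVneq i r.
  by apply: le_trans tr _; rewrite lerDl sumr_ge0.
have iNr : i \in N :\ r by rewrite !inE ir.
rewrite add0r; apply: le_trans (Ha' i iNr) _.
by apply: ler_sum => q _; have [] := Hs' i iNr.
Qed.

(** The triple is tested before the pair, as [agent_remove_pair] relies on nobody accepting the
    triple. A reduction uses at most three ranks, so [3 * k <= m] persists. *)
Lemma ordered_allocation k N m s : (3 * k <= m)%N -> ordered_instance k N m s ->
  has_allocation N m s.
Proof.
elim: k N m s => [|k IH] N m s km [Nk ag].
  exists (fun=> i0) => i; move/eqP: Nk; rewrite cards_eq0 => /eqP->.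
  by rewrite inE.
case: m km ag => [|[|[|m]]] km ag; [lia|lia|lia|].
have km0 : (3 * k <= m)%N by lia.
have sd i : i \in N -> descending (s i) by move=> /ag[].
have card_rest r : r \in N -> #|N :\ r| = k.
  by move=> rN; have := Nk; rewrite (cardsD1 r) rN add1n => -[].
have [/exists_inP[i1 i1N Hi1]|/exists_inPn no1] :=
    boolP [exists i in N, t i <= s i 0%N].
  have [r rN [tr Hr]] := choose_recipient (val := fun i => s i 0%N) i1N Hi1.
  apply: (@solve_reduced k N _ m.+2 s r (del 0) (fun u => u 0%N)) => //.
  - by move=> a'; apply: assign_del.
  - by move=> s'; apply: IH; lia.
  - by move=> q; have [s0 _] := sd r rN; apply: s0.
  move=> j jN; have [hk hh] := Hr j jN; rewrite (card_rest r rN) in hk.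
  apply: agent_remove_top (ag j _) hh => //; first lia.
  by move: jN; rewrite inE => /andP[].
have {}no1 i : i \in N -> s i 0%N < t i by move=> /no1; rewrite -ltNge.
have [/exists_inP[i1 i1N Hi1]|/exists_inPn no3] := boolP
    [exists i in N, t i <= s i k.*2 + s i k.*2.+1 + s i k.*2.+2].
  have [r rN [tr Hr]] := choose_recipient
    (val := fun i => s i k.*2 + s i k.*2.+1 + s i k.*2.+2) i1N Hi1.
  apply: (@solve_reduced k N _ m s r
    (fun u => del k.*2 (del k.*2 (del k.*2 u)))
    (fun u => u k.*2 + u k.*2.+1 + u k.*2.+2)) => //.
  - move=> a'.
    have [a1 Ha1] := @assign_del R _ k.*2 m r a' ltac:(lia).
    have [a2 Ha2] := @assign_del R _ k.*2 m.+1 r a1 ltac:(lia).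
    have [a3 Ha3] := @assign_del R _ k.*2 m.+2 r a2 ltac:(lia).
    exists a3 => i u; rewrite Ha3 Ha2 Ha1.
    rewrite ![del _ _ k.*2]del_ge // [del _ _ k.*2.+1]del_ge //.
    by case: ifP => _; ring.
  - by move=> s'; apply: IH.
  - by move=> q; have [s0 _] := sd r rN; apply: s0.
  move=> j jN; have [hk hh] := Hr j jN; rewrite (card_rest r rN) in hk.
  have jN' : j \in N by move: jN; rewrite inE => /andP[].
  apply: agent_remove_triple (ag j jN') (no1 j jN') hh => //; lia.
have {}no3 i : i \in N -> s i k.*2 + s i k.*2.+1 + s i k.*2.+2 < t i.
  by move=> /no3; rewrite -ltNge.
have [/exists_inP[i1 i1N Hi1]|/exists_inPn no2] := boolP
    [exists i in N, t i <= s i 0%N + s i k.*2.+2].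
  have [r rN [tr Hr]] := choose_recipient
    (val := fun i => s i 0%N + s i k.*2.+2) i1N Hi1.
  apply: (@solve_reduced k N _ m.+1 s r
    (fun u => del k.*2.+1 (del 0 u)) (fun u => u 0%N + u k.*2.+2)) => //.
  - move=> a'.
    have [a1 Ha1] := @assign_del R _ k.*2.+1 m.+1 r a' ltac:(lia).
    have [a2 Ha2] := @assign_del R _ 0 m.+2 r a1 ltac:(lia).
    exists a2 => i u; rewrite Ha2 Ha1 [del _ _ k.*2.+1]del_ge //.
    by case: ifP => _; ring.
  - by move=> s'; apply: IH; lia.
  - by move=> q; have [s0 _] := sd r rN; apply: s0.
  move=> j jN; have [hk hh] := Hr j jN; rewrite (card_rest r rN) in hk.
  have jN' : j \in N by move: jN; rewrite inE => /andP[].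
  apply: agent_remove_pair (ag j jN') (no1 j jN') (no3 j jN') hh => //; lia.
have {}no2 i : i \in N -> s i 0%N + s i k.*2.+2 < t i.
  by move=> /no2; rewrite -ltNge.
apply: (@allocate_bags _ _ _ k) => //; first lia.
move=> i iN; apply: agent_ready (ag i iN) (no1 i iN) (no3 i iN) (no2 i iN).
  by rewrite -Nk higher_lt.
lia.
Qed.

End Induction.

(** * Picking sequences, from ranks back to goods *)

Section Picking.
Variables (R : realFieldType) (M : finType).
Implicit Types (s : nat -> R) (w : M -> R).

(** [A] stands for the goods gone before turn [r]. The condition [0 < s r] leaves room for worthless
    ranks beyond the actual goods. *)
Definition pickable w s : Prop := forall r (A : {set M}),
  0 < s r -> (#|A| <= r)%N -> exists2 g, g \notin A & s r <= w g.

Lemma pickable_le w s s' : (forall r, s' r <= s r) -> pickable w s ->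
  pickable w s'.
Proof.
move=> le pk r A sr Ar; have [|g gA wg] := pk r A _ Ar.
  exact: lt_le_trans (le r).
by exists g => //; apply: le_trans wg.
Qed.

(** At turn [r], agent [a r] takes a free good worth at least [s (a r) r]; at most one good leaves
    per turn, so [pickable] provides it. Turns of no value are skipped, as are turns where no such
    good is left, whose agent is then not [pickable]. *)
Lemma picking_sequence n (w : 'I_n -> M -> R) (s : 'I_n -> nat -> R) m
    (a : nat -> 'I_n) : (forall i g, 0 <= w i g) ->
  exists X : M -> 'I_n, forall i, pickable (w i) (s i) ->
    \sum_(r < m | a r == i) s i r <= \sum_(g | X g == i) w i g.
Proof.
move=> w0.
suff [A [X [_ H]]] : exists (A : {set M}) (X : M -> 'I_n), (#|A| <= m)%N /\
    forall i, pickable (w i) (s i) -> \sum_(r < m | a r == i) s i r <=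
      \sum_(g in A | X g == i) w i g.
  exists X => i pk; apply: le_trans (H i pk) _.
  rewrite big_mkcond [leRHS]big_mkcond; apply: ler_sum => g _.
  by case: (g \in A); case: ifP.
elim: m => [|m [A [X [Am H]]]].
  exists set0, (fun=> a 0%N); split=> [|i _]; first by rewrite cards0.
  by rewrite big_ord0 sumr_ge0.
have [sm|sm] := ltP 0 (s (a m) m); last first.
  exists A, X; split=> [|i pk]; first exact: leqW.
  rewrite big_mkcond big_ord_recr /= -big_mkcond /=.
  by have := H i pk; case: eqP => [<-|_]; lra.
have skip : ~ pickable (w (a m)) (s (a m)) -> exists (A' : {set M}) X',
    (#|A'| <= m.+1)%N /\ forall i, pickable (w i) (s i) ->
    \sum_(r < m.+1 | a r == i) s i r <= \sum_(g in A' | X' g == i) w i g.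
  move=> npk; exists A, X; split=> [|i pk]; first exact: leqW.
  rewrite big_mkcond big_ord_recr /= -big_mkcond /=.
  by case: eqP => [E|_]; [rewrite E in npk | rewrite addr0 H].
have [/exists_inP[g gA wg]|/exists_inPn no] :=
    boolP [exists g in ~: A, s (a m) m <= w (a m) g]; last first.
  apply: skip => /(_ m A sm Am)[g gA]; apply/negP/no.
  by rewrite inE.
rewrite inE in gA.
exists (g |: A), (fun h => if h == g then a m else X h); split=> [|i pk].
  by rewrite cardsU1 gA add1n ltnS.
rewrite big_mkcond big_ord_recr /= -big_mkcond /=.
rewrite [leRHS](bigID (fun h => h == g)) /= [leRHS]addrC.
apply: lerD.
  apply: le_trans (H i pk) _; rewrite le_eqVlt; apply/orP; left; apply/eqP.
  apply: eq_bigl => h; rewrite !inE; case: (eqVneq h g) => [->|_] /=.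
    by rewrite (negbTE gA) andbF.
  by rewrite andbT.
case: eqP => [ami|_]; last exact: sumr_ge0.
rewrite (big_pred1 g) => [|h]; first by rewrite -ami.
by rewrite !inE /=; case: (eqVneq h g) => //=; rewrite ?andbF // ami eqxx.
Qed.

(** Sorting pads with zeros beyond the number of goods; the [r.+1] best goods cannot all lie in a
    set of at most [r]. *)
Lemma covering_of_partition n (w : M -> R) (B : M -> 'I_n) (b0 : 'I_n) m :
  (forall g, 0 <= w g) -> (forall b, 1 <= \sum_(g | B g == b) w g) ->
  (#|M| <= m)%N ->
  exists s, [/\ descending s, covering_partition n m s 0 & pickable w s].
Proof.
move=> w0 Bw Mm.
have [p [s [sd sE s0]]] := sort_ranks (fun i : 'I_#|M| => w0 (enum_val i)).
pose f (r : nat) := if insub r is Some i then B (enum_val (p i)) else b0.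
exists s; split=> //.
  exists f, (fun=> 0); split=> // [b|]; last by rewrite big1.
  rewrite addr0; apply: le_trans (Bw b) _; rewrite /bundle.
  apply: (@le_trans _ _ (\sum_(r < #|M| | f r == b) s r)); last first.
    rewrite (big_ord_widen_cond m (fun r => f r == b) s Mm).
    rewrite big_mkcond [leRHS]big_mkcond; apply: ler_sum => r _.
    by case: (f r == b) => //=; case: ifP => // _; case: sd.
  rewrite (reindex_onto (fun i : 'I_#|M| => enum_val i) enum_rank) /=;
    last by move=> g _; rewrite enum_rankK.
  rewrite (reindex_inj (@perm_inj _ p)) /= le_eqVlt; apply/orP; left; apply/eqP.
  apply: eq_big => i; first by rewrite enum_valK eqxx andbT /f valK.
  by rewrite sE.
move=> r A sr Ar.
have rM : (r < #|M|)%N.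
  by rewrite ltnNge; apply/negP => /s0 E; rewrite E ltxx in sr.
pose top := [set enum_val (p i) | i : 'I_#|M| & (i <= r)%N].
have [g gtop gA] : exists2 g, g \in top & g \notin A.
  apply/subsetPn; apply: contraTN Ar => /subset_leq_card.
  rewrite card_imset; last by apply: inj_comp enum_val_inj perm_inj.
  rewrite -ltnNge cardsE -sum1_card.
  by rewrite -(big_ord_widen _ (fun _ => 1%N) rM) sum1_card card_ord.
exists g => //; case/imsetP: gtop => i; rewrite inE => ir ->.
by rewrite -sE; case: sd => _; apply.
Qed.

(* Fictitious values for the agents with maximin share 0. *)
Lemma unit_goods_partition n m : (n.+1 <= m)%N ->
  exists s, descending s /\ normal_partition n.+1 m s 0.
Proof.
move=> nm; exists (fun r => if (r < n.+1)%N then 1 else 0); split.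
  split=> [r|p q pq]; first by case: ifP.
  by case: (ltnP q n.+1) => [/(leq_ltn_trans pq)->|_] //; case: ifP.
exists (fun r => inord r), (fun=> 0); split=> // [b|]; last by rewrite big1.
rewrite addr0 /bundle (bigD1 (widen_ord nm b)) /=; last first.
  by rewrite inord_val.
rewrite ltn_ord big1 ?addr0 // => r /andP[/eqP rb]; case: ifP => // rn.
by case/eqP; apply/val_inj; rewrite -rb /= inordK.
Qed.

End Picking.

(** * Scaling valuations by the maximin shares *)

Section InitialAgents.
Variable R : realType.


(** An optimal partition, scaled by the share, is a covering one; normalising lowers values, which
    keeps them pickable. A share of 0 promises nothing, so fictitious values do. *)
Lemma agent_of_valuation n (M : finType) (v : {set M} -> R) m :
  additive_valuation v -> (#|M| + n.+1 <= m)%N ->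
  exists s, [/\ descending s, normal_partition n.+1 m s 0 & 0 < mms n.+1 v ->
    pickable (fun g => v [set g] / mms n.+1 v) s].
Proof.
move=> va Mm; have [v0 vD] := va.
have [mms0|mms0] := ltP 0 (mms n.+1 v); last first.
  have [|s [sd N]] := @unit_goods_partition R n m; first lia.
  by exists s; split=> // _.
have [X [Xalloc XE]] := mms_attained (ltn0Sn n) va.
have /andP[/forallP Xdisj /eqP Xcover] := Xalloc.
pose B g : 'I_n.+1 := odflt ord0 [pick j | g \in X j].
have BE b : \sum_(g | B g == b) v [set g] = v (X b).
  rewrite vD; apply: eq_bigl => g; rewrite /B; case: pickP => [j gj|no] /=.
    apply/eqP/idP => [<- //|gb]; apply/eqP; apply: contraT => jb.
    have /forallP/(_ b) := Xdisj j; rewrite jb -setI_eq0 => /eqP/setP/(_ g).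
    by rewrite !inE gj gb.
  have : g \in \bigcup_j X j by rewrite Xcover inE.
  by case/bigcupP => j _; rewrite no.
have [|b|s [sd /(normalize sd)[s' [sd' le' N']] pk]] := @covering_of_partition
    R M n.+1 (fun g => v [set g] / mms n.+1 v) B ord0 m _ _ ltac:(lia).
- by move=> g; rewrite divr_ge0 // ltW.
- rewrite -mulr_suml BE ler_pdivlMr // mul1r XE; exact: min_bundle_le.
by exists s'; split=> // _; apply: pickable_le pk.
Qed.

Lemma tau_agent n m i s : (i < n.+1)%N -> (n.+1.*2 <= m)%N -> descending s ->
  normal_partition n.+1 m s 0 -> agent (tau R n.+1 i.+1) n.+1 i m s.
Proof.
move=> i_n nm sd N; split=> //; rewrite /tau.
have iR : i%:R <= n%:R :> R by rewrite ler_nat.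
have i0 : 0 <= i%:R :> R by [].
have e1 : 2 * n.+1%:R + i.+1%:R - 1 = 2 * n.+1%:R + i%:R :> R.
  by rewrite -[i.+1%:R]natr1; ring.
rewrite e1; set a := 2 * _ / _; set b := _ + _.
have den : 0 < 2 * n.+1%:R + i%:R :> R by rewrite -natr1; lra.
have [ab|ba] := lerP b a; [left | right].
  split.
    by rewrite /a ler_pdivlMr // -natr1; lra.
  apply: rank_invariant_init N => //.
    by rewrite /a ler_pdivlMr // -natr1; lra.
  by rewrite /a mulfVK // gt_eqF.
(* For one or two agents the first term of [tau] is the larger; at least three give [27 * e <= 1]
   for [e = 1 / (9 * n.+1)]. *)
have n3 : (2 <= n)%N.
  apply: contraTT ba; rewrite -ltnNge -leNgt /a ler_pdivlMr // /b => n2.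
  have [nE|nE] : n = 0%N \/ n = 1%N by clear -n2; lia.
    by move: iR; rewrite nE => iR; lra.
  by move: iR; rewrite nE => iR; lra.
have nR : 3 <= n.+1%:R :> R by rewrite (ler_nat _ 3).
have n0 : 1 + n%:R != 0 :> R by rewrite nat1r pnatr_eq0.
exists (1 / (9 * n.+1%:R)), 0; split=> //.
- by rewrite divr_ge0 // mulr_ge0.
- by rewrite mulrA ler_pdivrMr ?mulr_gt0 ?ltr0n //; lra.
- by rewrite /b; field.
- by rewrite add0r le_eqVlt; apply/orP; left; apply/eqP; field.
Qed.

End InitialAgents.

Theorem theorem2 (R : realType) (n : nat) (n_ge1 : (1 <= n)%N) (M : finType)
    (v : 'I_n -> {set M} -> R)
    (v_add : forall i : 'I_n, additive_valuation (v i)) :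
  exists X : {ffun 'I_n -> {set M}},
    mms_allocation v (fun i : 'I_n => tau R n i.+1) X.
Proof.
case: n n_ge1 v v_add => // n _ v v_add.
pose m := (#|M| + 3 * n.+1)%N.
have /fin_all_exists[s Hs] i :=
  @agent_of_valuation R n M (v i) m (v_add i) ltac:(lia).
pose w i g := v i [set g] / mms n.+1 (v i).
have mms0 i : 0 <= mms n.+1 (v i).
  have [X [_ ->]] := mms_attained (ltn0Sn n) (v_add i).
  have [j ->] := min_bundle_attained X (ltn0Sn n) (v_add i).
  by case: (v_add i).
have w0 i g : 0 <= w i g by rewrite divr_ge0 //; case: (v_add i).
have [|a Ha] := @ordered_allocation R n.+1 (fun i => tau R n.+1 i.+1) ord0 n.+1
    [set: 'I_n.+1] m s ltac:(lia).
  split=> [|i _]; first by rewrite cardsT card_ord.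
  have -> : num_higher [set: 'I_n.+1] i = i.
    rewrite /num_higher -sum1_card.
    rewrite (eq_bigl (fun j : 'I_n.+1 => (j < i)%N)) => [|j].
      rewrite -(big_ord_widen _ (fun _ => 1%N) (ltnW (ltn_ord i))).
      by rewrite sum1_card card_ord.
    by rewrite !inE.
  by have [sd N _] := Hs i; apply: tau_agent => //; lia.
have [X HX] := picking_sequence s m a w0.
exists [ffun j => [set g | X g == j]]; split.
  apply/andP; split.
    apply/forallP => j; apply/forallP => k; apply/implyP => jk; rewrite !ffunE.
    rewrite -setI_eq0; apply/eqP/setP => g; rewrite !inE.
    by case: eqP => // ->; apply/negbTE.
  rewrite eqEsubset subsetT /=; apply/subsetP => g _.
  by apply/bigcupP; exists (X g); rewrite // ffunE inE.
move=> i; rewrite ffunE; have [v0 vD] := v_add i.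
(* Only agents with a positive share rely on the picking sequence; any bundle suits the others. *)
have [mp|mn] := ltP 0 (mms n.+1 (v i)); last first.
  have -> : mms n.+1 (v i) = 0 by apply/eqP; rewrite eq_le mn mms0.
  by rewrite mulr0.
rewrite -ler_pdivlMr // vD mulr_suml.
apply: le_trans (Ha i (in_setT i)) _; have [_ _ pk] := Hs i.
apply: le_trans (HX i (pk mp)) _.
rewrite le_eqVlt; apply/orP; left; apply/eqP.
by apply: eq_bigl => g; rewrite inE.
Qed.
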